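(* Both $\mathbf{emTT}$ and $\mathbf{mTT}$ (the extensional and intensional levels of the Minimalist Foundation) do not validate the number-theoretic axiom of unique choice $$(\mathbf{AC!}_{\mathsf{N},\mathsf{N}})\qquad \forall_{x\in\mathsf{N}}\ \exists!_{y\in\mathsf{N}}\ R(x,y)\ \rightarrow\ \exists_{f\in\mathsf{N}\to\mathsf{N}}\ \forall_{x\in\mathsf{N}}\ R(x,f(x)).$$
   Context: Both $\mathbf{mTT}$ and $\mathbf{emTT}$ are dependent type theories in the style of Martin-Löf with four kinds of types: small propositions ($\mathit{prop}_s$), propositions ($\mathit{prop}$), sets, and collections. Every small proposition is a proposition and a set; every set and every proposition is a collection. $\mathbf{mTT}$ is intensional, $\mathbf{emTT}$ extensional. Sets of both: the empty set, the singleton, lists $List(A)$ over a set $A$ (hence the natural numbers $\mathsf{N}$), $\Sigma_{x\in A}B(x)$ and $\Pi_{x\in A}B(x)$ for families of sets over a set, disjoint sums, and small propositions, with the rules of first-order (intensional, resp. extensional) Martin-Löf type theory; inductive sets eliminate towards all collections. $\mathbf{emTT}$ also has effective quotients $A/R$ of a set by a small equivalence relation. $\mathsf{N}\to\mathsf{N}$ is the set of $\lambda$-terms (non-dependent $\Pi$). Collections of both: sets, propositions and $\Sigma_{x\in A}B(x)$ for families of collections. In addition $\mathbf{mTT}$ has the collection $\mathsf{prop_s}$ of (codes of) small propositions and $A\to\mathsf{prop_s}$ for a set $A$; $\mathbf{emTT}$ has $\mathcal{P}(1)$ and $A\to\mathcal{P}(1)$ for a set $A$, where $\mathcal{P}(1)$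 is the quotient of the collection of small propositions by equiprovability: each small $\phi$ gives $[\phi]\in\mathcal{P}(1)$, $[\phi]=[\psi]$ iff $\phi\leftrightarrow\psi$ is true, and each $U\in\mathcal{P}(1)$ equals $[\mathsf{Eq}(\mathcal{P}(1),U,[\top])]$, with $\mathsf{Eq}(\mathcal{P}(1),U,V)$ a small proposition. Propositions of both: falsum, conjunction, disjunction, implication, quantifiers over collections, and propositional equality: in $\mathbf{mTT}$ the intensional $\mathsf{Id}$ with elimination restricted to propositions, in $\mathbf{emTT}$ the extensional $\mathsf{Eq}$ with the reflection rule. Small propositions are those closed under connectives and under quantifiers and equalities restricted to sets. The rules are intuitionistic; elimination rules of propositions act only towards propositions. In $\mathbf{emTT}$ propositions are proof-irrelevant with canonical element $\mathsf{true}$; in $\mathbf{mTT}$ they carry proof-terms. $\exists!_{y\in\mathsf{N}}R(x,y)$ is $\exists_{y\in\mathsf{N}}R(x,y)$ together with uniqueness of such $y$ up to propositional equality. In the axiom scheme, $R$ ranges over small propositions $R(x,y)\ \mathit{prop}_s\ [x\in\mathsf{N},y\in\mathsf{N}]$; as usual in type theory, an ambient context common to all judgements is left implicit. A theory does not validate the axiom scheme if some instance of it is not derivable in the theory. *)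

(* Defs.v *)
(* Deep embedding of the two levels of the Minimalist Foundation: the
   intensional mTT and the extensional emTT.  Both calculi share one raw syntax
   (de Bruijn indices, no typing information beyond the annotations shown) and
   are given by one inductive family [der], indexed by the theory: a rule whose
   theory is a variable [T] belongs to both, the others only to the theory that
   they name. *)

From Stdlib Require Import List.
Import ListNotations.

Inductive theory := mTT | emTT.

(* The numbers of variables bound in an argument are indicated as (+n). *)
Inductive exp : Type :=
| Var (n : nat)
| Empty | Unit
| List (A : exp)
| Sig (A B : exp)                   (* B (+1) *)
| Pi (A B : exp)                    (* B (+1) *)
| Plus (A B : exp)
| Quot (A R : exp)                  (* R (+2); emTT *)
| PropS                             (* collection of codes of small propositions; mTT *)
| Pow1                              (* P(1); emTT *)
| Bot
| And (P Q : exp) | Or (P Q : exp) | Imp (P Q : exp)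
| All (A P : exp) | Ex (A P : exp)  (* P (+1) *)
| PEq (A a b : exp)                 (* Id(A,a,b) in mTT, Eq(A,a,b) in emTT *)
| Dec (p : exp)                     (* the proposition with code p; mTT *)
| ElEmpty (a : exp)
| Star | ElUnit (t c : exp)
| Nil | Cons (s a : exp)
| ElList (s a l : exp)              (* l (+3): tail, head, recursive value *)
| Pair (a b : exp)
| ElSig (d m : exp)                 (* m (+2) *)
| Lam (A b : exp)                   (* b (+1) *)
| App (f a : exp)
| Inl (a : exp) | Inr (b : exp)
| ElPlus (d b c : exp)              (* b, c (+1) *)
| Cls (a : exp)                     (* [a] in A/R; emTT *)
| ElQuot (p l : exp)                (* l (+1); emTT *)
| PCls (P : exp)                    (* [P] in P(1); emTT *)
(* codes, only in mTT *)
| cBot | cAnd (p q : exp) | cOr (p q : exp) | cImp (p q : exp)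
| cAll (A p : exp) | cEx (A p : exp) (* p (+1) *)
| cEq (A a b : exp)
(* proof-terms, only in mTT *)
| ElBot (a : exp)
| PairAnd (a b : exp) | FstAnd (d : exp) | SndAnd (d : exp)
| InlOr (a : exp) | InrOr (b : exp)
| ElOr (d b c : exp)                (* b, c (+1) *)
| LamImp (P b : exp)                (* b (+1) *)
| AppImp (f a : exp)
| LamAll (A b : exp)                (* b (+1) *)
| AppAll (f a : exp)
| PairEx (a b : exp)
| ElEx (d m : exp)                  (* m (+2) *)
| Refl (A a : exp)
| ElId (p c : exp)                  (* c (+1) *)
| Tru.                              (* the canonical proof true; emTT *)

Definition up_ren (r : nat -> nat) (n : nat) : nat :=
  match n with 0 => 0 | S m => S (r m) end.

Fixpoint ren (r : nat -> nat) (e : exp) : exp :=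
  let r1 := up_ren r in
  let r2 := up_ren r1 in
  let r3 := up_ren r2 in
  match e with
  | Var n => Var (r n)
  | Empty => Empty
  | Unit => Unit
  | List A => List (ren r A)
  | Sig A B => Sig (ren r A) (ren r1 B)
  | Pi A B => Pi (ren r A) (ren r1 B)
  | Plus A B => Plus (ren r A) (ren r B)
  | Quot A R => Quot (ren r A) (ren r2 R)
  | PropS => PropS
  | Pow1 => Pow1
  | Bot => Bot
  | And P Q => And (ren r P) (ren r Q)
  | Or P Q => Or (ren r P) (ren r Q)
  | Imp P Q => Imp (ren r P) (ren r Q)
  | All A P => All (ren r A) (ren r1 P)
  | Ex A P => Ex (ren r A) (ren r1 P)
  | PEq A a b => PEq (ren r A) (ren r a) (ren r b)
  | Dec p => Dec (ren r p)
  | ElEmpty a => ElEmpty (ren r a)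
  | Star => Star
  | ElUnit t c => ElUnit (ren r t) (ren r c)
  | Nil => Nil
  | Cons s a => Cons (ren r s) (ren r a)
  | ElList s a l => ElList (ren r s) (ren r a) (ren r3 l)
  | Pair a b => Pair (ren r a) (ren r b)
  | ElSig d m => ElSig (ren r d) (ren r2 m)
  | Lam A b => Lam (ren r A) (ren r1 b)
  | App f a => App (ren r f) (ren r a)
  | Inl a => Inl (ren r a)
  | Inr b => Inr (ren r b)
  | ElPlus d b c => ElPlus (ren r d) (ren r1 b) (ren r1 c)
  | Cls a => Cls (ren r a)
  | ElQuot p l => ElQuot (ren r p) (ren r1 l)
  | PCls P => PCls (ren r P)
  | cBot => cBot
  | cAnd p q => cAnd (ren r p) (ren r q)
  | cOr p q => cOr (ren r p) (ren r q)
  | cImp p q => cImp (ren r p) (ren r q)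
  | cAll A p => cAll (ren r A) (ren r1 p)
  | cEx A p => cEx (ren r A) (ren r1 p)
  | cEq A a b => cEq (ren r A) (ren r a) (ren r b)
  | ElBot a => ElBot (ren r a)
  | PairAnd a b => PairAnd (ren r a) (ren r b)
  | FstAnd d => FstAnd (ren r d)
  | SndAnd d => SndAnd (ren r d)
  | InlOr a => InlOr (ren r a)
  | InrOr b => InrOr (ren r b)
  | ElOr d b c => ElOr (ren r d) (ren r1 b) (ren r1 c)
  | LamImp P b => LamImp (ren r P) (ren r1 b)
  | AppImp f a => AppImp (ren r f) (ren r a)
  | LamAll A b => LamAll (ren r A) (ren r1 b)
  | AppAll f a => AppAll (ren r f) (ren r a)
  | PairEx a b => PairEx (ren r a) (ren r b)
  | ElEx d m => ElEx (ren r d) (ren r2 m)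
  | Refl A a => Refl (ren r A) (ren r a)
  | ElId p c => ElId (ren r p) (ren r1 c)
  | Tru => Tru
  end.

(* Weakening by [k] variables. *)
Definition wk (k : nat) : exp -> exp := ren (Nat.add k).

Definition scons (a : exp) (s : nat -> exp) (n : nat) : exp :=
  match n with 0 => a | S m => s m end.

Definition up (s : nat -> exp) : nat -> exp :=
  scons (Var 0) (fun n => wk 1 (s n)).

Fixpoint subst (s : nat -> exp) (e : exp) : exp :=
  let s1 := up s in
  let s2 := up s1 in
  let s3 := up s2 in
  match e with
  | Var n => s n
  | Empty => Empty
  | Unit => Unit
  | List A => List (subst s A)
  | Sig A B => Sig (subst s A) (subst s1 B)
  | Pi A B => Pi (subst s A) (subst s1 B)
  | Plus A B => Plus (subst s A) (subst s B)
  | Quot A R => Quot (subst s A) (subst s2 R)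
  | PropS => PropS
  | Pow1 => Pow1
  | Bot => Bot
  | And P Q => And (subst s P) (subst s Q)
  | Or P Q => Or (subst s P) (subst s Q)
  | Imp P Q => Imp (subst s P) (subst s Q)
  | All A P => All (subst s A) (subst s1 P)
  | Ex A P => Ex (subst s A) (subst s1 P)
  | PEq A a b => PEq (subst s A) (subst s a) (subst s b)
  | Dec p => Dec (subst s p)
  | ElEmpty a => ElEmpty (subst s a)
  | Star => Star
  | ElUnit t c => ElUnit (subst s t) (subst s c)
  | Nil => Nil
  | Cons t a => Cons (subst s t) (subst s a)
  | ElList t a l => ElList (subst s t) (subst s a) (subst s3 l)
  | Pair a b => Pair (subst s a) (subst s b)
  | ElSig d m => ElSig (subst s d) (subst s2 m)
  | Lam A b => Lam (subst s A) (subst s1 b)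
  | App f a => App (subst s f) (subst s a)
  | Inl a => Inl (subst s a)
  | Inr b => Inr (subst s b)
  | ElPlus d b c => ElPlus (subst s d) (subst s1 b) (subst s1 c)
  | Cls a => Cls (subst s a)
  | ElQuot p l => ElQuot (subst s p) (subst s1 l)
  | PCls P => PCls (subst s P)
  | cBot => cBot
  | cAnd p q => cAnd (subst s p) (subst s q)
  | cOr p q => cOr (subst s p) (subst s q)
  | cImp p q => cImp (subst s p) (subst s q)
  | cAll A p => cAll (subst s A) (subst s1 p)
  | cEx A p => cEx (subst s A) (subst s1 p)
  | cEq A a b => cEq (subst s A) (subst s a) (subst s b)
  | ElBot a => ElBot (subst s a)
  | PairAnd a b => PairAnd (subst s a) (subst s b)
  | FstAnd d => FstAnd (subst s d)
  | SndAnd d => SndAnd (subst s d)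
  | InlOr a => InlOr (subst s a)
  | InrOr b => InrOr (subst s b)
  | ElOr d b c => ElOr (subst s d) (subst s1 b) (subst s1 c)
  | LamImp P b => LamImp (subst s P) (subst s1 b)
  | AppImp f a => AppImp (subst s f) (subst s a)
  | LamAll A b => LamAll (subst s A) (subst s1 b)
  | AppAll f a => AppAll (subst s f) (subst s a)
  | PairEx a b => PairEx (subst s a) (subst s b)
  | ElEx d m => ElEx (subst s d) (subst s2 m)
  | Refl A a => Refl (subst s A) (subst s a)
  | ElId p c => ElId (subst s p) (subst s1 c)
  | Tru => Tru
  end.

(* [inst k M t] is M(t) for M depending on one variable over a context Γ and t
   living over an extension of Γ by k variables, where the result lives too;
   similarly for [inst2] and [inst3], whose arguments are listed in the order in
   which the variables are declared (so the last one replaces index 0). *)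
Definition inst (k : nat) (M t : exp) : exp :=
  subst (scons t (fun n => Var (k + n))) M.
Definition inst2 (k : nat) (M t u : exp) : exp :=
  subst (scons u (scons t (fun n => Var (k + n)))) M.
Definition inst3 (k : nat) (M t u v : exp) : exp :=
  subst (scons v (scons u (scons t (fun n => Var (k + n))))) M.

Definition Top : exp := Imp Bot Bot.
Definition Iff (P Q : exp) : exp := And (Imp P Q) (Imp Q P).
Definition Arr (A B : exp) : exp := Pi A (wk 1 B).
Definition N : exp := List Unit.

Inductive kind := prop_s | prop | set | col.

Inductive kle : kind -> kind -> Prop :=
| kle_props_prop : kle prop_s prop
| kle_props_set : kle prop_s set
| kle_set_col : kle set col
| kle_prop_col : kle prop col.

(* Most formation rules come in a small and a large version: sets and small
   propositions on the one hand, collections and propositions on the other. *)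
Inductive size := small | large.
Definition typ (s : size) : kind := match s with small => set | large => col end.
Definition prp (s : size) : kind := match s with small => prop_s | large => prop end.

(* The head of the list is the variable declared last. *)
Definition ctx := list exp.

Inductive judgement :=
| isCtx
| isTy (A : exp) (k : kind)
| eqTy (A B : exp) (k : kind)
| isTm (a A : exp)
| eqTm (a b A : exp).

Definition subst_j (s : nat -> exp) (J : judgement) : judgement :=
  match J with
  | isCtx => isCtx
  | isTy A k => isTy (subst s A) k
  | eqTy A B k => eqTy (subst s A) (subst s B) k
  | isTm a A => isTm (subst s a) (subst s A)
  | eqTm a b A => eqTm (subst s a) (subst s b) (subst s A)
  end.

Reserved Notation "Γ ⊢[ T ] J" (at level 70, T at level 0, J at level 65,
  format "Γ  ⊢[ T ]  J").

Inductive der : theory -> ctx -> judgement -> Prop :=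

| ctx_nil T :
    [] ⊢[T] isCtx
| ctx_cons T Γ A :
    Γ ⊢[T] isTy A col -> (A :: Γ) ⊢[T] isCtx
| var T Γ n A :
    Γ ⊢[T] isCtx -> nth_error Γ n = Some A -> Γ ⊢[T] isTm (Var n) (wk (S n) A)

| ty_cum T Γ A k k' :
    kle k k' -> Γ ⊢[T] isTy A k -> Γ ⊢[T] isTy A k'
| eqTy_cum T Γ A B k k' :
    kle k k' -> Γ ⊢[T] eqTy A B k -> Γ ⊢[T] eqTy A B k'

| eqTy_refl T Γ A k :
    Γ ⊢[T] isTy A k -> Γ ⊢[T] eqTy A A k
| eqTy_sym T Γ A B k :
    Γ ⊢[T] eqTy A B k -> Γ ⊢[T] eqTy B A k
| eqTy_trans T Γ A B C k :
    Γ ⊢[T] eqTy A B k -> Γ ⊢[T] eqTy B C k -> Γ ⊢[T] eqTy A C k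
| eqTm_refl T Γ a A :
    Γ ⊢[T] isTm a A -> Γ ⊢[T] eqTm a a A
| eqTm_sym T Γ a b A :
    Γ ⊢[T] eqTm a b A -> Γ ⊢[T] eqTm b a A
| eqTm_trans T Γ a b c A :
    Γ ⊢[T] eqTm a b A -> Γ ⊢[T] eqTm b c A -> Γ ⊢[T] eqTm a c A
| conv_tm T Γ a A B :
    Γ ⊢[T] isTm a A -> Γ ⊢[T] eqTy A B col -> Γ ⊢[T] isTm a B
| conv_eqTm T Γ a b A B :
    Γ ⊢[T] eqTm a b A -> Γ ⊢[T] eqTy A B col -> Γ ⊢[T] eqTm a b B

| substitution T Γ Δ s J :
    Γ ⊢[T] isCtx ->
    (forall n A, nth_error Δ n = Some A ->
       Γ ⊢[T] isTm (s n) (subst s (wk (S n) A))) ->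
    Δ ⊢[T] J ->
    Γ ⊢[T] subst_j s J
(* Replacement of equals.  In mTT [repl_tm] stands in place of the congruence
   rules for terms: there is no ξ-rule.  The congruences under binders of emTT
   are [eq_Lam], [eq_ElSig], [eq_ElList], [eq_ElPlus] and [eq_ElQuot]. *)
| repl_ty T Γ Δ s t C k :
    Γ ⊢[T] isCtx ->
    (forall n A, nth_error Δ n = Some A ->
       Γ ⊢[T] eqTm (s n) (t n) (subst s (wk (S n) A))) ->
    Δ ⊢[T] isTy C k ->
    Γ ⊢[T] eqTy (subst s C) (subst t C) k
| repl_tm T Γ Δ s t c C :
    Γ ⊢[T] isCtx ->
    (forall n A, nth_error Δ n = Some A ->
       Γ ⊢[T] eqTm (s n) (t n) (subst s (wk (S n) A))) ->
    Δ ⊢[T] isTm c C ->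
    Γ ⊢[T] eqTm (subst s c) (subst t c) (subst s C)

| F_Empty T Γ :
    Γ ⊢[T] isCtx -> Γ ⊢[T] isTy Empty set
| E_Empty T Γ M a :
    (Empty :: Γ) ⊢[T] isTy M col -> Γ ⊢[T] isTm a Empty ->
    Γ ⊢[T] isTm (ElEmpty a) (inst 0 M a)

| F_Unit T Γ :
    Γ ⊢[T] isCtx -> Γ ⊢[T] isTy Unit set
| I_Unit T Γ :
    Γ ⊢[T] isCtx -> Γ ⊢[T] isTm Star Unit
| E_Unit T Γ M t c :
    (Unit :: Γ) ⊢[T] isTy M col ->
    Γ ⊢[T] isTm t Unit -> Γ ⊢[T] isTm c (inst 0 M Star) ->
    Γ ⊢[T] isTm (ElUnit t c) (inst 0 M t)
| C_Unit T Γ M c :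
    (Unit :: Γ) ⊢[T] isTy M col -> Γ ⊢[T] isTm c (inst 0 M Star) ->
    Γ ⊢[T] eqTm (ElUnit Star c) c (inst 0 M Star)

| F_List T Γ A :
    Γ ⊢[T] isTy A set -> Γ ⊢[T] isTy (List A) set
| eq_List T Γ A A' :
    Γ ⊢[T] eqTy A A' set -> Γ ⊢[T] eqTy (List A) (List A') set
| I_Nil T Γ A :
    Γ ⊢[T] isTy A set -> Γ ⊢[T] isTm Nil (List A)
| I_Cons T Γ A s a :
    Γ ⊢[T] isTm s (List A) -> Γ ⊢[T] isTm a A -> Γ ⊢[T] isTy A set ->
    Γ ⊢[T] isTm (Cons s a) (List A)
| E_List T Γ A M s a l :
    Γ ⊢[T] isTy A set ->
    (List A :: Γ) ⊢[T] isTy M col ->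
    Γ ⊢[T] isTm s (List A) ->
    Γ ⊢[T] isTm a (inst 0 M Nil) ->
    (inst 2 M (Var 1) :: wk 1 A :: List A :: Γ)
      ⊢[T] isTm l (inst 3 M (Cons (Var 2) (Var 1))) ->
    Γ ⊢[T] isTm (ElList s a l) (inst 0 M s)
| C_Nil T Γ A M a l :
    Γ ⊢[T] isTy A set ->
    (List A :: Γ) ⊢[T] isTy M col ->
    Γ ⊢[T] isTm a (inst 0 M Nil) ->
    (inst 2 M (Var 1) :: wk 1 A :: List A :: Γ)
      ⊢[T] isTm l (inst 3 M (Cons (Var 2) (Var 1))) ->
    Γ ⊢[T] eqTm (ElList Nil a l) a (inst 0 M Nil)
| C_Cons T Γ A M s c a l :
    Γ ⊢[T] isTy A set ->
    (List A :: Γ) ⊢[T] isTy M col ->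
    Γ ⊢[T] isTm s (List A) ->
    Γ ⊢[T] isTm c A ->
    Γ ⊢[T] isTm a (inst 0 M Nil) ->
    (inst 2 M (Var 1) :: wk 1 A :: List A :: Γ)
      ⊢[T] isTm l (inst 3 M (Cons (Var 2) (Var 1))) ->
    Γ ⊢[T] eqTm (ElList (Cons s c) a l) (inst3 0 l s c (ElList s a l))
                (inst 0 M (Cons s c))
| eq_ElList Γ A M s s' a a' l l' :
    Γ ⊢[emTT] isTy A set ->
    (List A :: Γ) ⊢[emTT] isTy M col ->
    Γ ⊢[emTT] eqTm s s' (List A) ->
    Γ ⊢[emTT] eqTm a a' (inst 0 M Nil) ->
    (inst 2 M (Var 1) :: wk 1 A :: List A :: Γ)
      ⊢[emTT] eqTm l l' (inst 3 M (Cons (Var 2) (Var 1))) ->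
    Γ ⊢[emTT] eqTm (ElList s a l) (ElList s' a' l') (inst 0 M s)

| F_Sig T Γ A B i :
    Γ ⊢[T] isTy A (typ i) -> (A :: Γ) ⊢[T] isTy B (typ i) ->
    Γ ⊢[T] isTy (Sig A B) (typ i)
| eq_Sig T Γ A A' B B' i :
    Γ ⊢[T] eqTy A A' (typ i) -> (A :: Γ) ⊢[T] eqTy B B' (typ i) ->
    Γ ⊢[T] eqTy (Sig A B) (Sig A' B') (typ i)
| I_Sig T Γ A B a b :
    Γ ⊢[T] isTm a A -> Γ ⊢[T] isTm b (inst 0 B a) -> (A :: Γ) ⊢[T] isTy B col ->
    Γ ⊢[T] isTm (Pair a b) (Sig A B)
| E_Sig T Γ A B M d m :
    (Sig A B :: Γ) ⊢[T] isTy M col ->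
    Γ ⊢[T] isTm d (Sig A B) ->
    (B :: A :: Γ) ⊢[T] isTm m (inst 2 M (Pair (Var 1) (Var 0))) ->
    Γ ⊢[T] isTm (ElSig d m) (inst 0 M d)
| C_Sig T Γ A B M a b m :
    (Sig A B :: Γ) ⊢[T] isTy M col ->
    Γ ⊢[T] isTm a A -> Γ ⊢[T] isTm b (inst 0 B a) ->
    (B :: A :: Γ) ⊢[T] isTm m (inst 2 M (Pair (Var 1) (Var 0))) ->
    Γ ⊢[T] eqTm (ElSig (Pair a b) m) (inst2 0 m a b) (inst 0 M (Pair a b))
| eq_ElSig Γ A B M d d' m m' :
    (Sig A B :: Γ) ⊢[emTT] isTy M col ->
    Γ ⊢[emTT] eqTm d d' (Sig A B) ->
    (B :: A :: Γ) ⊢[emTT] eqTm m m' (inst 2 M (Pair (Var 1) (Var 0))) ->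
    Γ ⊢[emTT] eqTm (ElSig d m) (ElSig d' m') (inst 0 M d)

(* The collections A → prop_s and A → P(1), for A a set, are written as
   non-dependent products, so that they share the rules of the latter: the
   premise [isTy (Pi A B) col] below covers the three cases. *)
| F_Pi T Γ A B :
    Γ ⊢[T] isTy A set -> (A :: Γ) ⊢[T] isTy B set -> Γ ⊢[T] isTy (Pi A B) set
| eq_Pi T Γ A A' B B' :
    Γ ⊢[T] eqTy A A' set -> (A :: Γ) ⊢[T] eqTy B B' set ->
    Γ ⊢[T] eqTy (Pi A B) (Pi A' B') set
| F_ArrPropS Γ A :
    Γ ⊢[mTT] isTy A set -> Γ ⊢[mTT] isTy (Arr A PropS) col
| eq_ArrPropS Γ A A' :
    Γ ⊢[mTT] eqTy A A' set -> Γ ⊢[mTT] eqTy (Arr A PropS) (Arr A' PropS) col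
| F_ArrPow1 Γ A :
    Γ ⊢[emTT] isTy A set -> Γ ⊢[emTT] isTy (Arr A Pow1) col
| eq_ArrPow1 Γ A A' :
    Γ ⊢[emTT] eqTy A A' set -> Γ ⊢[emTT] eqTy (Arr A Pow1) (Arr A' Pow1) col
| I_Pi T Γ A B b :
    Γ ⊢[T] isTy (Pi A B) col -> (A :: Γ) ⊢[T] isTm b B ->
    Γ ⊢[T] isTm (Lam A b) (Pi A B)
| E_Pi T Γ A B f a :
    Γ ⊢[T] isTy (Pi A B) col ->
    Γ ⊢[T] isTm f (Pi A B) -> Γ ⊢[T] isTm a A ->
    Γ ⊢[T] isTm (App f a) (inst 0 B a)
| C_Pi T Γ A B b a :
    Γ ⊢[T] isTy (Pi A B) col ->
    (A :: Γ) ⊢[T] isTm b B -> Γ ⊢[T] isTm a A ->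
    Γ ⊢[T] eqTm (App (Lam A b) a) (inst 0 b a) (inst 0 B a)
| eq_Lam Γ A A' B b b' :
    Γ ⊢[emTT] isTy (Pi A B) col ->
    Γ ⊢[emTT] eqTy A A' set -> (A :: Γ) ⊢[emTT] eqTm b b' B ->
    Γ ⊢[emTT] eqTm (Lam A b) (Lam A' b') (Pi A B)
| eta_Pi Γ A B f :
    Γ ⊢[emTT] isTy (Pi A B) col -> Γ ⊢[emTT] isTm f (Pi A B) ->
    Γ ⊢[emTT] eqTm (Lam A (App (wk 1 f) (Var 0))) f (Pi A B)

| F_Plus T Γ A B :
    Γ ⊢[T] isTy A set -> Γ ⊢[T] isTy B set -> Γ ⊢[T] isTy (Plus A B) set
| eq_Plus T Γ A A' B B' :
    Γ ⊢[T] eqTy A A' set -> Γ ⊢[T] eqTy B B' set ->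
    Γ ⊢[T] eqTy (Plus A B) (Plus A' B') set
| I_Inl T Γ A B a :
    Γ ⊢[T] isTy A set -> Γ ⊢[T] isTy B set -> Γ ⊢[T] isTm a A ->
    Γ ⊢[T] isTm (Inl a) (Plus A B)
| I_Inr T Γ A B b :
    Γ ⊢[T] isTy A set -> Γ ⊢[T] isTy B set -> Γ ⊢[T] isTm b B ->
    Γ ⊢[T] isTm (Inr b) (Plus A B)
| E_Plus T Γ A B M d b c :
    Γ ⊢[T] isTy A set -> Γ ⊢[T] isTy B set ->
    (Plus A B :: Γ) ⊢[T] isTy M col ->
    Γ ⊢[T] isTm d (Plus A B) ->
    (A :: Γ) ⊢[T] isTm b (inst 1 M (Inl (Var 0))) ->
    (B :: Γ) ⊢[T] isTm c (inst 1 M (Inr (Var 0))) ->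
    Γ ⊢[T] isTm (ElPlus d b c) (inst 0 M d)
| C_Inl T Γ A B M a b c :
    Γ ⊢[T] isTy A set -> Γ ⊢[T] isTy B set ->
    (Plus A B :: Γ) ⊢[T] isTy M col ->
    Γ ⊢[T] isTm a A ->
    (A :: Γ) ⊢[T] isTm b (inst 1 M (Inl (Var 0))) ->
    (B :: Γ) ⊢[T] isTm c (inst 1 M (Inr (Var 0))) ->
    Γ ⊢[T] eqTm (ElPlus (Inl a) b c) (inst 0 b a) (inst 0 M (Inl a))
| C_Inr T Γ A B M a b c :
    Γ ⊢[T] isTy A set -> Γ ⊢[T] isTy B set ->
    (Plus A B :: Γ) ⊢[T] isTy M col ->
    Γ ⊢[T] isTm a B ->
    (A :: Γ) ⊢[T] isTm b (inst 1 M (Inl (Var 0))) ->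
    (B :: Γ) ⊢[T] isTm c (inst 1 M (Inr (Var 0))) ->
    Γ ⊢[T] eqTm (ElPlus (Inr a) b c) (inst 0 c a) (inst 0 M (Inr a))
| eq_ElPlus Γ A B M d d' b b' c c' :
    Γ ⊢[emTT] isTy A set -> Γ ⊢[emTT] isTy B set ->
    (Plus A B :: Γ) ⊢[emTT] isTy M col ->
    Γ ⊢[emTT] eqTm d d' (Plus A B) ->
    (A :: Γ) ⊢[emTT] eqTm b b' (inst 1 M (Inl (Var 0))) ->
    (B :: Γ) ⊢[emTT] eqTm c c' (inst 1 M (Inr (Var 0))) ->
    Γ ⊢[emTT] eqTm (ElPlus d b c) (ElPlus d' b' c') (inst 0 M d)

| F_Bot T Γ :
    Γ ⊢[T] isCtx -> Γ ⊢[T] isTy Bot prop_s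
| F_And T Γ P Q i :
    Γ ⊢[T] isTy P (prp i) -> Γ ⊢[T] isTy Q (prp i) -> Γ ⊢[T] isTy (And P Q) (prp i)
| F_Or T Γ P Q i :
    Γ ⊢[T] isTy P (prp i) -> Γ ⊢[T] isTy Q (prp i) -> Γ ⊢[T] isTy (Or P Q) (prp i)
| F_Imp T Γ P Q i :
    Γ ⊢[T] isTy P (prp i) -> Γ ⊢[T] isTy Q (prp i) -> Γ ⊢[T] isTy (Imp P Q) (prp i)
| F_All T Γ A P i :
    Γ ⊢[T] isTy A (typ i) -> (A :: Γ) ⊢[T] isTy P (prp i) ->
    Γ ⊢[T] isTy (All A P) (prp i)
| F_Ex T Γ A P i :
    Γ ⊢[T] isTy A (typ i) -> (A :: Γ) ⊢[T] isTy P (prp i) ->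
    Γ ⊢[T] isTy (Ex A P) (prp i)
| F_PEq T Γ A a b i :
    Γ ⊢[T] isTy A (typ i) -> Γ ⊢[T] isTm a A -> Γ ⊢[T] isTm b A ->
    Γ ⊢[T] isTy (PEq A a b) (prp i)
| eq_And T Γ P P' Q Q' i :
    Γ ⊢[T] eqTy P P' (prp i) -> Γ ⊢[T] eqTy Q Q' (prp i) ->
    Γ ⊢[T] eqTy (And P Q) (And P' Q') (prp i)
| eq_Or T Γ P P' Q Q' i :
    Γ ⊢[T] eqTy P P' (prp i) -> Γ ⊢[T] eqTy Q Q' (prp i) ->
    Γ ⊢[T] eqTy (Or P Q) (Or P' Q') (prp i)
| eq_Imp T Γ P P' Q Q' i :
    Γ ⊢[T] eqTy P P' (prp i) -> Γ ⊢[T] eqTy Q Q' (prp i) ->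
    Γ ⊢[T] eqTy (Imp P Q) (Imp P' Q') (prp i)
| eq_All T Γ A A' P P' i :
    Γ ⊢[T] eqTy A A' (typ i) -> (A :: Γ) ⊢[T] eqTy P P' (prp i) ->
    Γ ⊢[T] eqTy (All A P) (All A' P') (prp i)
| eq_Ex T Γ A A' P P' i :
    Γ ⊢[T] eqTy A A' (typ i) -> (A :: Γ) ⊢[T] eqTy P P' (prp i) ->
    Γ ⊢[T] eqTy (Ex A P) (Ex A' P') (prp i)
| eq_PEq T Γ A A' a a' b b' i :
    Γ ⊢[T] eqTy A A' (typ i) -> Γ ⊢[T] eqTm a a' A -> Γ ⊢[T] eqTm b b' A ->
    Γ ⊢[T] eqTy (PEq A a b) (PEq A' a' b') (prp i)

| E_Bot_m Γ P a :
    Γ ⊢[mTT] isTm a Bot -> Γ ⊢[mTT] isTy P prop -> Γ ⊢[mTT] isTm (ElBot a) P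

| I_And_m Γ P Q a b :
    Γ ⊢[mTT] isTy P prop -> Γ ⊢[mTT] isTy Q prop ->
    Γ ⊢[mTT] isTm a P -> Γ ⊢[mTT] isTm b Q ->
    Γ ⊢[mTT] isTm (PairAnd a b) (And P Q)
| E_And1_m Γ P Q d :
    Γ ⊢[mTT] isTy P prop -> Γ ⊢[mTT] isTy Q prop ->
    Γ ⊢[mTT] isTm d (And P Q) -> Γ ⊢[mTT] isTm (FstAnd d) P
| E_And2_m Γ P Q d :
    Γ ⊢[mTT] isTy P prop -> Γ ⊢[mTT] isTy Q prop ->
    Γ ⊢[mTT] isTm d (And P Q) -> Γ ⊢[mTT] isTm (SndAnd d) Q
| C_And1_m Γ P Q a b :
    Γ ⊢[mTT] isTy P prop -> Γ ⊢[mTT] isTy Q prop ->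
    Γ ⊢[mTT] isTm a P -> Γ ⊢[mTT] isTm b Q ->
    Γ ⊢[mTT] eqTm (FstAnd (PairAnd a b)) a P
| C_And2_m Γ P Q a b :
    Γ ⊢[mTT] isTy P prop -> Γ ⊢[mTT] isTy Q prop ->
    Γ ⊢[mTT] isTm a P -> Γ ⊢[mTT] isTm b Q ->
    Γ ⊢[mTT] eqTm (SndAnd (PairAnd a b)) b Q

| I_Or1_m Γ P Q a :
    Γ ⊢[mTT] isTy P prop -> Γ ⊢[mTT] isTy Q prop ->
    Γ ⊢[mTT] isTm a P -> Γ ⊢[mTT] isTm (InlOr a) (Or P Q)
| I_Or2_m Γ P Q b :
    Γ ⊢[mTT] isTy P prop -> Γ ⊢[mTT] isTy Q prop ->
    Γ ⊢[mTT] isTm b Q -> Γ ⊢[mTT] isTm (InrOr b) (Or P Q)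
| E_Or_m Γ P Q M d b c :
    Γ ⊢[mTT] isTy M prop ->
    Γ ⊢[mTT] isTy P prop -> Γ ⊢[mTT] isTy Q prop ->
    Γ ⊢[mTT] isTm d (Or P Q) ->
    (P :: Γ) ⊢[mTT] isTm b (wk 1 M) -> (Q :: Γ) ⊢[mTT] isTm c (wk 1 M) ->
    Γ ⊢[mTT] isTm (ElOr d b c) M
| C_Or1_m Γ P Q M a b c :
    Γ ⊢[mTT] isTy M prop ->
    Γ ⊢[mTT] isTy P prop -> Γ ⊢[mTT] isTy Q prop ->
    Γ ⊢[mTT] isTm a P ->
    (P :: Γ) ⊢[mTT] isTm b (wk 1 M) -> (Q :: Γ) ⊢[mTT] isTm c (wk 1 M) ->
    Γ ⊢[mTT] eqTm (ElOr (InlOr a) b c) (inst 0 b a) M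
| C_Or2_m Γ P Q M a b c :
    Γ ⊢[mTT] isTy M prop ->
    Γ ⊢[mTT] isTy P prop -> Γ ⊢[mTT] isTy Q prop ->
    Γ ⊢[mTT] isTm a Q ->
    (P :: Γ) ⊢[mTT] isTm b (wk 1 M) -> (Q :: Γ) ⊢[mTT] isTm c (wk 1 M) ->
    Γ ⊢[mTT] eqTm (ElOr (InrOr a) b c) (inst 0 c a) M

| I_Imp_m Γ P Q b :
    Γ ⊢[mTT] isTy P prop -> Γ ⊢[mTT] isTy Q prop ->
    (P :: Γ) ⊢[mTT] isTm b (wk 1 Q) -> Γ ⊢[mTT] isTm (LamImp P b) (Imp P Q)
| E_Imp_m Γ P Q f a :
    Γ ⊢[mTT] isTy P prop -> Γ ⊢[mTT] isTy Q prop ->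
    Γ ⊢[mTT] isTm f (Imp P Q) -> Γ ⊢[mTT] isTm a P ->
    Γ ⊢[mTT] isTm (AppImp f a) Q
| C_Imp_m Γ P Q b a :
    Γ ⊢[mTT] isTy P prop -> Γ ⊢[mTT] isTy Q prop ->
    (P :: Γ) ⊢[mTT] isTm b (wk 1 Q) -> Γ ⊢[mTT] isTm a P ->
    Γ ⊢[mTT] eqTm (AppImp (LamImp P b) a) (inst 0 b a) Q

| I_All_m Γ A P b :
    (A :: Γ) ⊢[mTT] isTy P prop -> (A :: Γ) ⊢[mTT] isTm b P ->
    Γ ⊢[mTT] isTm (LamAll A b) (All A P)
| E_All_m Γ A P f a :
    (A :: Γ) ⊢[mTT] isTy P prop ->
    Γ ⊢[mTT] isTm f (All A P) -> Γ ⊢[mTT] isTm a A ->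
    Γ ⊢[mTT] isTm (AppAll f a) (inst 0 P a)
| C_All_m Γ A P b a :
    (A :: Γ) ⊢[mTT] isTy P prop ->
    (A :: Γ) ⊢[mTT] isTm b P -> Γ ⊢[mTT] isTm a A ->
    Γ ⊢[mTT] eqTm (AppAll (LamAll A b) a) (inst 0 b a) (inst 0 P a)

| I_Ex_m Γ A P a b :
    (A :: Γ) ⊢[mTT] isTy P prop ->
    Γ ⊢[mTT] isTm a A -> Γ ⊢[mTT] isTm b (inst 0 P a) ->
    Γ ⊢[mTT] isTm (PairEx a b) (Ex A P)
| E_Ex_m Γ A P M d m :
    Γ ⊢[mTT] isTy M prop ->
    (A :: Γ) ⊢[mTT] isTy P prop ->
    Γ ⊢[mTT] isTm d (Ex A P) ->
    (P :: A :: Γ) ⊢[mTT] isTm m (wk 2 M) ->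
    Γ ⊢[mTT] isTm (ElEx d m) M
| C_Ex_m Γ A P M a b m :
    Γ ⊢[mTT] isTy M prop ->
    (A :: Γ) ⊢[mTT] isTy P prop ->
    Γ ⊢[mTT] isTm a A -> Γ ⊢[mTT] isTm b (inst 0 P a) ->
    (P :: A :: Γ) ⊢[mTT] isTm m (wk 2 M) ->
    Γ ⊢[mTT] eqTm (ElEx (PairEx a b) m) (inst2 0 m a b) M

| I_Id Γ A a :
    Γ ⊢[mTT] isTy A col -> Γ ⊢[mTT] isTm a A ->
    Γ ⊢[mTT] isTm (Refl A a) (PEq A a a)
| E_Id Γ A C a b p c :
    (wk 1 A :: A :: Γ) ⊢[mTT] isTy C prop ->
    Γ ⊢[mTT] isTm a A -> Γ ⊢[mTT] isTm b A ->
    Γ ⊢[mTT] isTm p (PEq A a b) ->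
    (A :: Γ) ⊢[mTT] isTm c (inst2 1 C (Var 0) (Var 0)) ->
    Γ ⊢[mTT] isTm (ElId p c) (inst2 0 C a b)
| C_Id Γ A C a c :
    (wk 1 A :: A :: Γ) ⊢[mTT] isTy C prop ->
    Γ ⊢[mTT] isTm a A ->
    (A :: Γ) ⊢[mTT] isTm c (inst2 1 C (Var 0) (Var 0)) ->
    Γ ⊢[mTT] eqTm (ElId (Refl A a) c) (inst 0 c a) (inst2 0 C a a)

| F_PropS Γ :
    Γ ⊢[mTT] isCtx -> Γ ⊢[mTT] isTy PropS col
| F_Dec Γ p :
    Γ ⊢[mTT] isTm p PropS -> Γ ⊢[mTT] isTy (Dec p) prop_s
| I_cBot Γ :
    Γ ⊢[mTT] isCtx -> Γ ⊢[mTT] isTm cBot PropS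
| I_cAnd Γ p q :
    Γ ⊢[mTT] isTm p PropS -> Γ ⊢[mTT] isTm q PropS -> Γ ⊢[mTT] isTm (cAnd p q) PropS
| I_cOr Γ p q :
    Γ ⊢[mTT] isTm p PropS -> Γ ⊢[mTT] isTm q PropS -> Γ ⊢[mTT] isTm (cOr p q) PropS
| I_cImp Γ p q :
    Γ ⊢[mTT] isTm p PropS -> Γ ⊢[mTT] isTm q PropS -> Γ ⊢[mTT] isTm (cImp p q) PropS
| I_cAll Γ A p :
    Γ ⊢[mTT] isTy A set -> (A :: Γ) ⊢[mTT] isTm p PropS ->
    Γ ⊢[mTT] isTm (cAll A p) PropS
| I_cEx Γ A p :
    Γ ⊢[mTT] isTy A set -> (A :: Γ) ⊢[mTT] isTm p PropS ->
    Γ ⊢[mTT] isTm (cEx A p) PropS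
| I_cEq Γ A a b :
    Γ ⊢[mTT] isTy A set -> Γ ⊢[mTT] isTm a A -> Γ ⊢[mTT] isTm b A ->
    Γ ⊢[mTT] isTm (cEq A a b) PropS
| C_cBot Γ :
    Γ ⊢[mTT] isCtx -> Γ ⊢[mTT] eqTy (Dec cBot) Bot prop_s
| C_cAnd Γ p q :
    Γ ⊢[mTT] isTm p PropS -> Γ ⊢[mTT] isTm q PropS ->
    Γ ⊢[mTT] eqTy (Dec (cAnd p q)) (And (Dec p) (Dec q)) prop_s
| C_cOr Γ p q :
    Γ ⊢[mTT] isTm p PropS -> Γ ⊢[mTT] isTm q PropS ->
    Γ ⊢[mTT] eqTy (Dec (cOr p q)) (Or (Dec p) (Dec q)) prop_s
| C_cImp Γ p q :
    Γ ⊢[mTT] isTm p PropS -> Γ ⊢[mTT] isTm q PropS ->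
    Γ ⊢[mTT] eqTy (Dec (cImp p q)) (Imp (Dec p) (Dec q)) prop_s
| C_cAll Γ A p :
    Γ ⊢[mTT] isTy A set -> (A :: Γ) ⊢[mTT] isTm p PropS ->
    Γ ⊢[mTT] eqTy (Dec (cAll A p)) (All A (Dec p)) prop_s
| C_cEx Γ A p :
    Γ ⊢[mTT] isTy A set -> (A :: Γ) ⊢[mTT] isTm p PropS ->
    Γ ⊢[mTT] eqTy (Dec (cEx A p)) (Ex A (Dec p)) prop_s
| C_cEq Γ A a b :
    Γ ⊢[mTT] isTy A set -> Γ ⊢[mTT] isTm a A -> Γ ⊢[mTT] isTm b A ->
    Γ ⊢[mTT] eqTy (Dec (cEq A a b)) (PEq A a b) prop_s

| prop_mono Γ P p q :
    Γ ⊢[emTT] isTy P prop -> Γ ⊢[emTT] isTm p P -> Γ ⊢[emTT] isTm q P ->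
    Γ ⊢[emTT] eqTm p q P
| prop_true Γ P p :
    Γ ⊢[emTT] isTy P prop -> Γ ⊢[emTT] isTm p P -> Γ ⊢[emTT] isTm Tru P

| E_Bot_e Γ P :
    Γ ⊢[emTT] isTm Tru Bot -> Γ ⊢[emTT] isTy P prop -> Γ ⊢[emTT] isTm Tru P

| I_And_e Γ P Q :
    Γ ⊢[emTT] isTy P prop -> Γ ⊢[emTT] isTy Q prop ->
    Γ ⊢[emTT] isTm Tru P -> Γ ⊢[emTT] isTm Tru Q -> Γ ⊢[emTT] isTm Tru (And P Q)
| E_And1_e Γ P Q :
    Γ ⊢[emTT] isTy P prop -> Γ ⊢[emTT] isTy Q prop ->
    Γ ⊢[emTT] isTm Tru (And P Q) -> Γ ⊢[emTT] isTm Tru P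
| E_And2_e Γ P Q :
    Γ ⊢[emTT] isTy P prop -> Γ ⊢[emTT] isTy Q prop ->
    Γ ⊢[emTT] isTm Tru (And P Q) -> Γ ⊢[emTT] isTm Tru Q

| I_Or1_e Γ P Q :
    Γ ⊢[emTT] isTy P prop -> Γ ⊢[emTT] isTy Q prop ->
    Γ ⊢[emTT] isTm Tru P -> Γ ⊢[emTT] isTm Tru (Or P Q)
| I_Or2_e Γ P Q :
    Γ ⊢[emTT] isTy P prop -> Γ ⊢[emTT] isTy Q prop ->
    Γ ⊢[emTT] isTm Tru Q -> Γ ⊢[emTT] isTm Tru (Or P Q)
| E_Or_e Γ P Q M :
    Γ ⊢[emTT] isTy M prop ->
    Γ ⊢[emTT] isTy P prop -> Γ ⊢[emTT] isTy Q prop ->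
    Γ ⊢[emTT] isTm Tru (Or P Q) ->
    (P :: Γ) ⊢[emTT] isTm Tru (wk 1 M) -> (Q :: Γ) ⊢[emTT] isTm Tru (wk 1 M) ->
    Γ ⊢[emTT] isTm Tru M

| I_Imp_e Γ P Q :
    Γ ⊢[emTT] isTy P prop -> Γ ⊢[emTT] isTy Q prop ->
    (P :: Γ) ⊢[emTT] isTm Tru (wk 1 Q) -> Γ ⊢[emTT] isTm Tru (Imp P Q)
| E_Imp_e Γ P Q :
    Γ ⊢[emTT] isTy P prop -> Γ ⊢[emTT] isTy Q prop ->
    Γ ⊢[emTT] isTm Tru (Imp P Q) -> Γ ⊢[emTT] isTm Tru P ->
    Γ ⊢[emTT] isTm Tru Q

| I_All_e Γ A P :
    (A :: Γ) ⊢[emTT] isTy P prop -> (A :: Γ) ⊢[emTT] isTm Tru P ->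
    Γ ⊢[emTT] isTm Tru (All A P)
| E_All_e Γ A P a :
    (A :: Γ) ⊢[emTT] isTy P prop ->
    Γ ⊢[emTT] isTm Tru (All A P) -> Γ ⊢[emTT] isTm a A ->
    Γ ⊢[emTT] isTm Tru (inst 0 P a)

| I_Ex_e Γ A P a :
    (A :: Γ) ⊢[emTT] isTy P prop ->
    Γ ⊢[emTT] isTm a A -> Γ ⊢[emTT] isTm Tru (inst 0 P a) ->
    Γ ⊢[emTT] isTm Tru (Ex A P)
| E_Ex_e Γ A P M :
    Γ ⊢[emTT] isTy M prop ->
    (A :: Γ) ⊢[emTT] isTy P prop ->
    Γ ⊢[emTT] isTm Tru (Ex A P) ->
    (P :: A :: Γ) ⊢[emTT] isTm Tru (wk 2 M) ->
    Γ ⊢[emTT] isTm Tru M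

| I_Eq Γ A a :
    Γ ⊢[emTT] isTy A col -> Γ ⊢[emTT] isTm a A ->
    Γ ⊢[emTT] isTm Tru (PEq A a a)
| E_Eq Γ A a b :
    Γ ⊢[emTT] isTm a A -> Γ ⊢[emTT] isTm b A ->
    Γ ⊢[emTT] isTm Tru (PEq A a b) ->
    Γ ⊢[emTT] eqTm a b A

| F_Quot Γ A R :
    Γ ⊢[emTT] isTy A set ->
    (wk 1 A :: A :: Γ) ⊢[emTT] isTy R prop_s ->
    (A :: Γ) ⊢[emTT] isTm Tru (inst2 1 R (Var 0) (Var 0)) ->
    (R :: wk 1 A :: A :: Γ) ⊢[emTT] isTm Tru (inst2 3 R (Var 1) (Var 2)) ->
    (inst2 4 R (Var 2) (Var 1) :: inst2 3 R (Var 2) (Var 1)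
       :: wk 2 A :: wk 1 A :: A :: Γ)
      ⊢[emTT] isTm Tru (inst2 5 R (Var 4) (Var 2)) ->
    Γ ⊢[emTT] isTy (Quot A R) set
| eq_Quot Γ A A' R R' :
    Γ ⊢[emTT] isTy (Quot A R) set -> Γ ⊢[emTT] isTy (Quot A' R') set ->
    Γ ⊢[emTT] eqTy A A' set ->
    (wk 1 A :: A :: Γ) ⊢[emTT] eqTy R R' prop_s ->
    Γ ⊢[emTT] eqTy (Quot A R) (Quot A' R') set
| I_Quot Γ A R a :
    Γ ⊢[emTT] isTy (Quot A R) set -> Γ ⊢[emTT] isTm a A ->
    Γ ⊢[emTT] isTm (Cls a) (Quot A R)
| eq_Cls Γ A R a b :
    Γ ⊢[emTT] isTy (Quot A R) set ->
    Γ ⊢[emTT] isTm a A -> Γ ⊢[emTT] isTm b A ->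
    Γ ⊢[emTT] isTm Tru (inst2 0 R a b) ->
    Γ ⊢[emTT] eqTm (Cls a) (Cls b) (Quot A R)
| eff_Quot Γ A R a b :
    Γ ⊢[emTT] isTy (Quot A R) set ->
    Γ ⊢[emTT] isTm a A -> Γ ⊢[emTT] isTm b A ->
    Γ ⊢[emTT] eqTm (Cls a) (Cls b) (Quot A R) ->
    Γ ⊢[emTT] isTm Tru (inst2 0 R a b)
| E_Quot Γ A R M p l :
    (Quot A R :: Γ) ⊢[emTT] isTy M col ->
    Γ ⊢[emTT] isTm p (Quot A R) ->
    (A :: Γ) ⊢[emTT] isTm l (inst 1 M (Cls (Var 0))) ->
    (R :: wk 1 A :: A :: Γ)
      ⊢[emTT] eqTm (inst 3 l (Var 2)) (inst 3 l (Var 1)) (inst 3 M (Cls (Var 2))) ->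
    Γ ⊢[emTT] isTm (ElQuot p l) (inst 0 M p)
| C_Quot Γ A R M a l :
    (Quot A R :: Γ) ⊢[emTT] isTy M col ->
    Γ ⊢[emTT] isTm a A ->
    (A :: Γ) ⊢[emTT] isTm l (inst 1 M (Cls (Var 0))) ->
    (R :: wk 1 A :: A :: Γ)
      ⊢[emTT] eqTm (inst 3 l (Var 2)) (inst 3 l (Var 1)) (inst 3 M (Cls (Var 2))) ->
    Γ ⊢[emTT] eqTm (ElQuot (Cls a) l) (inst 0 l a) (inst 0 M (Cls a))
| eq_ElQuot Γ A R M p p' l l' :
    (Quot A R :: Γ) ⊢[emTT] isTy M col ->
    Γ ⊢[emTT] eqTm p p' (Quot A R) ->
    (A :: Γ) ⊢[emTT] eqTm l l' (inst 1 M (Cls (Var 0))) ->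
    (R :: wk 1 A :: A :: Γ)
      ⊢[emTT] eqTm (inst 3 l (Var 2)) (inst 3 l (Var 1)) (inst 3 M (Cls (Var 2))) ->
    Γ ⊢[emTT] eqTm (ElQuot p l) (ElQuot p' l') (inst 0 M p)

| F_Pow1 Γ :
    Γ ⊢[emTT] isCtx -> Γ ⊢[emTT] isTy Pow1 col
| I_Pow1 Γ P :
    Γ ⊢[emTT] isTy P prop_s -> Γ ⊢[emTT] isTm (PCls P) Pow1
| eq_PCls Γ P Q :
    Γ ⊢[emTT] isTy P prop_s -> Γ ⊢[emTT] isTy Q prop_s ->
    Γ ⊢[emTT] isTm Tru (Iff P Q) ->
    Γ ⊢[emTT] eqTm (PCls P) (PCls Q) Pow1
| eff_PCls Γ P Q :
    Γ ⊢[emTT] isTy P prop_s -> Γ ⊢[emTT] isTy Q prop_s ->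
    Γ ⊢[emTT] eqTm (PCls P) (PCls Q) Pow1 ->
    Γ ⊢[emTT] isTm Tru (Iff P Q)
| F_EqPow1 Γ U V :
    Γ ⊢[emTT] isTm U Pow1 -> Γ ⊢[emTT] isTm V Pow1 ->
    Γ ⊢[emTT] isTy (PEq Pow1 U V) prop_s
| eta_Pow1 Γ U :
    Γ ⊢[emTT] isTm U Pow1 ->
    Γ ⊢[emTT] eqTm U (PCls (PEq Pow1 U (PCls Top))) Pow1

where "Γ ⊢[ T ] J" := (der T Γ J).

Definition ExUnique (A P : exp) : exp :=
  And (Ex A P)
      (All A (All (wk 1 A)
         (Imp (And (inst 2 P (Var 1)) (inst 2 P (Var 0)))
              (PEq (wk 2 A) (Var 1) (Var 0))))).

(* In R(x,y), the variable x has index 1 and y has index 0. *)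
Definition AC_NN (R : exp) : exp :=
  Imp (All N (ExUnique N R))
      (Ex (Arr N N) (All N (inst2 2 R (Var 0) (App (Var 1) (Var 0))))).

(* An instance of the scheme is given by R(x,y) prop_s [Γ, x ∈ N, y ∈ N], for
   an arbitrary ambient context Γ. *)
Definition AC_NN_instance (T : theory) (Γ : ctx) (R : exp) : Prop :=
  (N :: N :: Γ) ⊢[T] isTy R prop_s.

Definition derivable (T : theory) (Γ : ctx) (P : exp) : Prop :=
  exists p : exp, Γ ⊢[T] isTm p P.

Definition does_not_validate_AC_NN (T : theory) : Prop :=
  exists (Γ : ctx) (R : exp),
    AC_NN_instance T Γ R /\ ~ derivable T Γ (AC_NN R).

(* Main.v *)
From Stdlib Require Import List PeanoNat Cantor Classical FunctionalExtensionality
    PropExtensionality.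
Require Import Defs.
Import ListNotations.

(** Both theories are interpreted in one realizability model, in which truth is
    classical but only countably many functions on the natural numbers exist.

    The realizers are the raw expressions themselves, run by the deterministic
    weak head reduction [step].  A type denotes a relation on expressions
    ([interp]) that is symmetric, transitive and insensitive to reduction; its
    elements are the expressions related to themselves, and two of them are
    equal when they are related.  Thus a term under a substitution denotes
    itself, and equality is extensional enough for emTT.  A proposition
    denotes the total or the empty relation: its proofs carry no information
    and its truth is the truth of the metatheory, so that intuitionistic and
    proof-irrelevant rules hold alike.  An element of prop_s or of P(1)
    is an expression that evaluates to a code of a proposition, and two of them
    are equal when these propositions have the same truth value; with this
    reading prop_s and P(1) can be the same relation, and one model serves the
    two theories ([soundness]).

    In this model a function from N to N must be realized by an
    expression, whereas a predicate need not be computable: the interpretation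
    is parametrized by an arbitrary predicate [orc_true], and the inert
    expression [oracle], applied to [t], codes a proposition that is true when
    [orc_true t] is.  So [oracle] is a predicate on each set whose equality
    [orc_true] respects.  Evaluation never inspects codes, so the choice of
    [orc_true] does not add functions.  Expressions being countable ([code_inj]), there is a function
    [diag] that differs, at the code of [f], from the function realized by [f],
    for every expression [f].

    Hence, in the context r : N x N -> prop_s (for emTT, r : N x N -> P(1)), the
    relation R(x,y) := r(x,y) is an instance of unique choice that fails: give r
    the value [oracle], with the graph of [diag] for [orc_true].  The premise is
    true since [diag] is a total function, and the conclusion is false since no
    expression realizes it ([AC_NN_false]). *)

(** * Substitution *)

Lemma up_Var r : up (fun n => Var (r n)) = fun n => Var (up_ren r n).
Proof. extensionality n; destruct n; reflexivity. Qed.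

Lemma up_up_ren s r : (fun n => up s (up_ren r n)) = up (fun n => s (r n)).
Proof. extensionality n; destruct n; reflexivity. Qed.

Ltac by_IH H :=
  first [reflexivity | match goal with IH : forall _, _ |- _ => rewrite IH, ?H; reflexivity end].

Lemma ren_as_subst e : forall r, ren r e = subst (fun n => Var (r n)) e.
Proof.
  induction e; intros r; simpl; rewrite ?up_Var; f_equal; auto.
Qed.

Lemma subst_ren e : forall s r, subst s (ren r e) = subst (fun n => s (r n)) e.
Proof.
  induction e; intros s r; simpl; try f_equal; by_IH up_up_ren.
Qed.

Lemma ren_ren r r' e : ren r (ren r' e) = ren (fun n => r (r' n)) e.
Proof. rewrite ren_as_subst, subst_ren, <- ren_as_subst; reflexivity. Qed.

Lemma ren_up r s : (fun n => ren (up_ren r) (up s n)) = up (fun n => ren r (s n)).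
Proof.
  extensionality n; destruct n; simpl; [reflexivity|].
  unfold wk; rewrite !ren_ren; reflexivity.
Qed.

Lemma ren_subst e : forall r s, ren r (subst s e) = subst (fun n => ren r (s n)) e.
Proof.
  induction e; intros r s; simpl; try f_equal; by_IH ren_up.
Qed.

Lemma subst_up s t : (fun n => subst (up s) (up t n)) = up (fun n => subst s (t n)).
Proof.
  extensionality n; destruct n; simpl; [reflexivity|].
  unfold wk; rewrite subst_ren, ren_subst; reflexivity.
Qed.

Lemma subst_subst e : forall s t, subst s (subst t e) = subst (fun n => subst s (t n)) e.
Proof.
  induction e; intros s t; simpl; try f_equal; by_IH subst_up.
Qed.

Lemma subst_wk s k A : subst s (wk k A) = subst (fun n => s (k + n)) A.
Proof. apply subst_ren. Qed.

Lemma subst_inst s k M t :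
  subst s (inst k M t) = subst (scons (subst s t) (fun n => s (k + n))) M.
Proof.
  unfold inst; rewrite subst_subst; f_equal.
  extensionality n; destruct n; reflexivity.
Qed.

Lemma subst_inst2 s k M t u :
  subst s (inst2 k M t u) =
  subst (scons (subst s u) (scons (subst s t) (fun n => s (k + n)))) M.
Proof.
  unfold inst2; rewrite subst_subst; f_equal.
  extensionality n; destruct n as [|[|n]]; reflexivity.
Qed.

Lemma subst_inst3 s k M t u v :
  subst s (inst3 k M t u v) =
  subst (scons (subst s v) (scons (subst s u) (scons (subst s t) (fun n => s (k + n))))) M.
Proof.
  unfold inst3; rewrite subst_subst; f_equal.
  extensionality n; destruct n as [|[|[|n]]]; reflexivity.
Qed.

Lemma scons_up a f s :
  (fun n => subst (scons a f) (up s n)) = scons a (fun n => subst f (s n)).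
Proof.
  extensionality n; destruct n; simpl; [reflexivity|].
  rewrite subst_wk; reflexivity.
Qed.

Lemma subst_id e : subst Var e = e.
Proof.
  assert (U : up Var = Var)
    by (extensionality n; destruct n; reflexivity).
  induction e; simpl; rewrite ?U; f_equal; auto.
Qed.

Lemma subst_Var (s : nat -> exp) : (fun n => subst Var (s n)) = s.
Proof. extensionality n; apply subst_id. Qed.

Lemma inst_up s M a : inst 0 (subst (up s) M) a = subst (scons a s) M.
Proof.
  unfold inst; rewrite subst_subst, scons_up; simpl; rewrite subst_Var; reflexivity.
Qed.

Lemma inst2_up s M a b :
  inst2 0 (subst (up (up s)) M) a b = subst (scons b (scons a s)) M.
Proof.
  unfold inst2; rewrite subst_subst, !scons_up; simpl; rewrite subst_Var; reflexivity.
Qed.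

Lemma inst3_up s M a b c :
  inst3 0 (subst (up (up (up s))) M) a b c = subst (scons c (scons b (scons a s))) M.
Proof.
  unfold inst3; rewrite subst_subst, !scons_up; simpl; rewrite subst_Var; reflexivity.
Qed.

(** * Evaluation *)

(** Proof terms do not reduce, because all proofs of a true proposition are identified.
    The eliminator of the singleton may discard its argument since all expressions are
    equal elements of the singleton. *)
Fixpoint step (e : exp) : option exp :=
  match e with
  | ElUnit t c => Some c
  | ElList t a l =>
      match t with
      | Nil => Some a
      | Cons u c => Some (inst3 0 l u c (ElList u a l))
      | _ => option_map (fun t' => ElList t' a l) (step t)
      end
  | ElSig d m =>
      match d with
      | Pair a b => Some (inst2 0 m a b)
      | _ => option_map (fun d' => ElSig d' m) (step d)
      end
  | App f a =>
      match f with
      | Lam _ b => Some (inst 0 b a)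
      | _ => option_map (fun f' => App f' a) (step f)
      end
  | ElPlus d b c =>
      match d with
      | Inl a => Some (inst 0 b a)
      | Inr a => Some (inst 0 c a)
      | _ => option_map (fun d' => ElPlus d' b c) (step d)
      end
  | ElQuot p l =>
      match p with
      | Cls a => Some (inst 0 l a)
      | _ => option_map (fun p' => ElQuot p' l) (step p)
      end
  | _ => None
  end.

Inductive red : exp -> exp -> Prop :=
| red_refl t : red t t
| red_step t u v : step t = Some u -> red u v -> red t v.

Lemma red_cong (C : exp -> exp) :
  (forall t u, step t = Some u -> step (C t) = Some (C u)) ->
  forall t u, red t u -> red (C t) (C u).
Proof. intros HC t u H; induction H; eauto using red. Qed.

Lemma step_App a t u : step t = Some u -> step (App t a) = Some (App u a).
Proof. intros H; destruct t; try discriminate H;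
    exact (f_equal (option_map (fun t => App t a)) H). Qed.
Lemma step_ElList a l t u : step t = Some u -> step (ElList t a l) = Some (ElList u a l).
Proof. intros H; destruct t; try discriminate H;
    exact (f_equal (option_map (fun t => ElList t a l)) H). Qed.
Lemma step_ElSig m t u : step t = Some u -> step (ElSig t m) = Some (ElSig u m).
Proof. intros H; destruct t; try discriminate H;
    exact (f_equal (option_map (fun t => ElSig t m)) H). Qed.
Lemma step_ElPlus b c t u : step t = Some u -> step (ElPlus t b c) = Some (ElPlus u b c).
Proof. intros H; destruct t; try discriminate H;
    exact (f_equal (option_map (fun t => ElPlus t b c)) H). Qed.
Lemma step_ElQuot l t u : step t = Some u -> step (ElQuot t l) = Some (ElQuot u l).
Proof. intros H; destruct t; try discriminate H;
    exact (f_equal (option_map (fun t => ElQuot t l)) H). Qed.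

Lemma red_det t v w :
  red t v -> red t w -> step v = None -> step w = None -> v = w.
Proof.
  intros H; revert w; induction H as [t|t u v E H IH]; intros w Hw Nv Nw;
    destruct Hw as [t|t u' w E' Hw]; try congruence.
  rewrite E in E'; injection E' as ->; auto.
Qed.

Lemma red_back t u v : step t = Some u -> red t v -> step v = None -> red u v.
Proof. intros E H N; destruct H as [|? ? ? E' H]; congruence. Qed.

(** * Partial equivalence relations on expressions *)

Definition rel := exp -> exp -> Prop.

Lemma rel_ext (X Y : rel) : (forall t u, X t u <-> Y t u) -> X = Y.
Proof.
  intros H; extensionality t; extensionality u; apply propositional_extensionality; auto.
Qed.

(** Invariance under [step] on the left suffices, by symmetry. *)
Record saturated (X : rel) : Prop := {
  saturated_sym : forall t u, X t u -> X u t;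
  saturated_trans : forall t u v, X t u -> X u v -> X t v;
  saturated_step : forall t t' u, step t = Some t' -> (X t u <-> X t' u) }.

(** The relations denoted by propositions: total or empty.  For such a relation,
    [inh] says that it is total, by testing an arbitrary pair. *)
Definition irrelevant (X : rel) : Prop := forall t u t' u', X t u -> X t' u'.

Definition inh (X : rel) : Prop := X Tru Tru.

Definition truth (P : Prop) : rel := fun _ _ => P.

Inductive listR (X : rel) : rel :=
| listR_nil t u : red t Nil -> red u Nil -> listR X t u
| listR_cons t u t1 t2 u1 u2 :
    red t (Cons t1 t2) -> red u (Cons u1 u2) ->
    listR X t1 u1 -> X t2 u2 -> listR X t u.

(** The family [F] is meant to depend on its argument only up to [X]; this is
    required separately, by [respects]. *)
Definition sigR (X : rel) (F : exp -> rel) : rel := fun t u =>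
  exists t1 t2 u1 u2, red t (Pair t1 t2) /\ red u (Pair u1 u2) /\
    X t1 u1 /\ F t1 t2 u2.

(** Application is tested on related arguments and no normal form is required
    of functions, so the rules of extensionality and eta hold. *)
Definition piR (X : rel) (F : exp -> rel) : rel := fun t u =>
  forall a b, X a b -> F a (App t a) (App u b).

Definition plusR (X Y : rel) : rel := fun t u =>
  (exists t1 u1, red t (Inl t1) /\ red u (Inl u1) /\ X t1 u1) \/
  (exists t1 u1, red t (Inr t1) /\ red u (Inr u1) /\ Y t1 u1).

(** Classes are compared by the truth of the relation on their representatives, not
    identified by a choice of representatives; this makes quotients effective. *)
Definition quotR (X : rel) (G : exp -> exp -> rel) : rel := fun t u =>
  exists t1 u1, red t (Cls t1) /\ red u (Cls u1) /\ X t1 t1 /\ X u1 u1 /\ inh (G t1 u1).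

Definition respects (X : rel) (F : exp -> rel) : Prop := forall a b, X a b -> F a = F b.

Definition equiv_on (X : rel) (G : exp -> exp -> rel) : Prop :=
  (forall a, X a a -> inh (G a a)) /\
  (forall a b, X a a -> X b b -> inh (G a b) -> inh (G b a)) /\
  (forall a b c, X a a -> X b b -> X c c -> inh (G a b) -> inh (G b c) -> inh (G a c)).

Ltac whnf_det :=
  match goal with
  | H : red ?t ?v, H' : red ?t ?w |- _ =>
      let E := fresh in
      assert (E : v = w) by (apply (red_det t); auto);
      clear H'; try discriminate E; (injection E; intros; subst; clear E)
  end.

Lemma saturated_truth P : saturated (truth P).
Proof. split; unfold truth; tauto. Qed.

Lemma irrelevant_truth P : irrelevant (truth P).
Proof. intros ? ? ? ?; auto. Qed.

Lemma red_iff t t' v : step t = Some t' -> step v = None -> (red t v <-> red t' v).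
Proof. split; eauto using red, red_back. Qed.

Lemma saturated_refl_l X t u : saturated X -> X t u -> X t t.
Proof. intros [s r _] H; eauto. Qed.

Lemma saturated_refl_r X t u : saturated X -> X t u -> X u u.
Proof. intros [s r _] H; eauto. Qed.

Lemma saturated_step_r X t u u' : saturated X -> step u = Some u' -> (X t u <-> X t u').
Proof. intros [s r p] E; specialize (p u u' t E); split; intros; apply s, p, s; auto. Qed.

Lemma saturated_red X t u v : saturated X -> red t u -> (X t v <-> X u v).
Proof.
  intros W H; induction H as [|t u w E H IH]; [tauto|].
  rewrite <- IH; apply (saturated_step X W); auto.
Qed.

Lemma saturated_red_r X t u v : saturated X -> red t u -> (X v t <-> X v u).
Proof.
  intros W H; split; intros; apply (saturated_sym X W), (saturated_red X _ _ _ W H),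
      (saturated_sym X W); auto.
Qed.

Ltac by_per :=
  match goal with
  | |- ?X ?t ?u =>
      first [ assumption
            | eapply (saturated_sym X); [solve [auto]|eassumption]
            | eapply (saturated_refl_l X); [solve [auto]|eassumption]
            | eapply (saturated_refl_r X); [solve [auto]|eassumption]
            | eapply (saturated_trans X); [solve [auto]|eassumption|eassumption] ]
  end.

Lemma saturated_listR X : saturated X -> saturated (listR X).
Proof.
  intros W; split.
  - induction 1; [constructor 1|econstructor 2]; eauto; by_per.
  - intros t u v H; revert v.
    induction H as [t u Ht Hu|t u t1 t2 u1 u2 Ht Hu H IH HX]; intros v Hv;
      destruct Hv as [u v Hu' Hv|u v u1' u2' v1 v2 Hu' Hv Hv' HX'];
      try whnf_det; try discriminate.
    + constructor 1; auto.
    + econstructor 2; eauto; by_per.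
  - intros t t' u E; split; intros H; destruct H;
      [constructor 1|econstructor 2|constructor 1|econstructor 2]; eauto;
      eapply (red_iff _ _ _ E); eauto.
Qed.

Lemma saturated_sigR X F : saturated X -> (forall a, X a a -> saturated (F a)) ->
    respects X F -> saturated (sigR X F).
Proof.
  intros W WF R; split.
  - intros t u (t1 & t2 & u1 & u2 & ? & ? & H1 & H2).
    assert (saturated (F t1)) by (apply WF; by_per).
    exists u1, u2, t1, t2; repeat split; auto; [by_per|].
    rewrite <- (R _ _ H1); by_per.
  - intros t u v (t1 & t2 & u1 & u2 & ? & ? & H1 & H2) (u1' & u2' & v1 & v2 & ? & ? & H1' & H2').
    whnf_det. assert (saturated (F t1)) by (apply WF; by_per).
    exists t1, t2, v1, v2; repeat split; auto; [by_per|].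
    rewrite <- (R _ _ H1) in H2'; by_per.
  - intros t t' u E; split; intros (t1 & t2 & u1 & u2 & ? & ? & H1 & H2);
      exists t1, t2, u1, u2; repeat split; auto; eapply (red_iff t t'); eauto.
Qed.

Lemma saturated_piR X F : saturated X -> (forall a, X a a -> saturated (F a)) -> respects X F ->
    saturated (piR X F).
Proof.
  intros W WF R.
  assert (WF' : forall a b, X a b -> saturated (F a)) by (intros; apply WF; by_per).
  split.
  - intros t u H a b Hab. apply saturated_sym; [eauto|].
    rewrite (R _ _ Hab). apply H; by_per.
  - intros t u v H H' a b Hab.
    apply (saturated_trans (F a)) with (App u a); [eauto|apply H; by_per|apply H'; auto].
  - intros t t' u E; split; intros H a b Hab;
      (apply (saturated_step (F a) (WF' _ _ Hab) _ _ _ (step_App a _ _ E)); auto).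
Qed.

Lemma saturated_plusR X Y : saturated X -> saturated Y -> saturated (plusR X Y).
Proof.
  intros W V; split.
  - intros t u [(t1 & u1 & ? & ? & ?)|(t1 & u1 & ? & ? & ?)]; [left|right];
      exists u1, t1; repeat split; auto; by_per.
  - intros t u v [(t1 & u1 & ? & ? & ?)|(t1 & u1 & ? & ? & ?)]
      [(u1' & v1 & ? & ? & ?)|(u1' & v1 & ? & ? & ?)]; whnf_det; [left|right];
      exists t1, v1; repeat split; auto; by_per.
  - intros t t' u E; split; (intros [(t1 & u1 & ? & ? & ?)|(t1 & u1 & ? & ? & ?)];
      [left|right]; exists t1, u1; repeat split; auto; eapply (red_iff t t'); eauto).
Qed.

Lemma saturated_quotR X G : equiv_on X G -> saturated (quotR X G).
Proof.
  intros (R & S & T); split.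
  - intros t u (t1 & u1 & ? & ? & ? & ? & ?); exists u1, t1; repeat split; eauto.
  - intros t u v (t1 & u1 & ? & ? & ? & ? & ?) (u1' & v1 & ? & ? & ? & ? & ?).
    whnf_det; exists t1, v1; repeat split; eauto.
  - intros t t' u E; split; intros (t1 & u1 & ? & ? & ? & ? & ?); exists t1, u1;
      repeat split; auto; eapply (red_iff t t'); eauto.
Qed.

Lemma sigR_ext X F F' : saturated X -> (forall a, X a a -> F a = F' a) -> sigR X F = sigR X F'.
Proof.
  intros W E; apply rel_ext; intros t u; unfold sigR; split;
    intros (t1 & t2 & u1 & u2 & ? & ? & H & ?); exists t1, t2, u1, u2; repeat split; auto;
    [rewrite <- E|rewrite E]; auto; by_per.
Qed.

Lemma piR_ext X F F' : saturated X -> (forall a, X a a -> F a = F' a) -> piR X F = piR X F'.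
Proof.
  intros W E; apply rel_ext; intros t u; unfold piR; split; intros H a b Hab;
    [rewrite <- E|rewrite E]; auto; by_per.
Qed.

Lemma quotR_ext X G G' :
  (forall a b, X a a -> X b b -> G a b = G' a b) -> quotR X G = quotR X G'.
Proof.
  intros E; apply rel_ext; intros t u; unfold quotR; split;
    intros (t1 & u1 & ? & ? & ? & ? & ?); exists t1, u1; repeat split; auto;
    [rewrite <- E|rewrite E]; auto.
Qed.

Lemma truth_ext (P Q : Prop) : (P <-> Q) -> truth P = truth Q.
Proof. intros H; apply rel_ext; auto. Qed.

Lemma irrelevant_eq X Y : irrelevant X -> irrelevant Y -> (inh X <-> inh Y) -> X = Y.
Proof.
  intros IX IY H; apply rel_ext; intros t u; split; intros Htu;
    [eapply IY, H, IX, Htu|eapply IX, H, IY, Htu].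
Qed.

(** * The interpretation of types *)

Definition decode (v : exp) : option exp :=
  match v with
  | PCls P => Some P
  | cBot => Some Bot
  | cAnd p q => Some (And (Dec p) (Dec q))
  | cOr p q => Some (Or (Dec p) (Dec q))
  | cImp p q => Some (Imp (Dec p) (Dec q))
  | cAll A p => Some (All A (Dec p))
  | cEx A p => Some (Ex A (Dec p))
  | cEq A a b => Some (PEq A a b)
  | _ => None
  end.

(** Any expression without a reduct that is not an abstraction would do: the point
    is that [App oracle t] is in weak head normal form and unknown to [decode]. *)
Definition oracle : exp := Tru.

Section Model.

Context (orc_true : exp -> Prop).

(** [interp U A X] says that the type expression [A] denotes [X].  With [U] equal to
    [None] it concerns the sets and small propositions; with [Some R] also the
    collections, where [R] is the denotation of both prop_s and P(1).  This
    stratification is forced: equality of codes refers to the denotations of small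
    propositions, so it can be defined ([propR]) only when the small part is complete.

    Denotation is a relation, not a function on expressions, because [Dec p] denotes
    what the value of [p] codes, which is no subexpression of [p].  Families are
    indexed by arbitrary functions [F]; only their values on elements matter.
    Equality in P(1) is a small proposition although P(1) is not a set, so it has a
    clause that speaks of truth values; the general clause excludes P(1) in order
    that at most one clause applies. *)
Inductive interp (U : option rel) : exp -> rel -> Prop :=
| interp_PropS R : U = Some R -> interp U PropS R
| interp_Pow1 R : U = Some R -> interp U Pow1 R
| interp_Empty : interp U Empty (truth False)
| interp_Unit : interp U Unit (truth True)
| interp_List A X : interp U A X -> interp U (List A) (listR X)
| interp_Sig A B X F :
    interp U A X -> (forall a, X a a -> interp U (inst 0 B a) (F a)) -> respects X F ->
    interp U (Sig A B) (sigR X F)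
| interp_Pi A B X F :
    interp U A X -> (forall a, X a a -> interp U (inst 0 B a) (F a)) -> respects X F ->
    interp U (Pi A B) (piR X F)
| interp_Plus A B X Y : interp U A X -> interp U B Y -> interp U (Plus A B) (plusR X Y)
| interp_Quot A R X G :
    interp U A X ->
    (forall a b, X a a -> X b b -> interp U (inst2 0 R a b) (G a b)) ->
    (forall a b, X a a -> X b b -> irrelevant (G a b)) ->
    (forall a a' b b', X a a' -> X b b' -> G a b = G a' b') ->
    equiv_on X G ->
    interp U (Quot A R) (quotR X G)
| interp_Bot : interp U Bot (truth False)
| interp_And P Q X Y : interp U P X -> interp U Q Y -> interp U (And P Q) (truth (inh X /\ inh Y))
| interp_Or P Q X Y : interp U P X -> interp U Q Y -> interp U (Or P Q) (truth (inh X \/ inh Y))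
| interp_Imp P Q X Y : interp U P X -> interp U Q Y -> interp U (Imp P Q) (truth (inh X -> inh Y))
| interp_All A P X F :
    interp U A X -> (forall a, X a a -> interp U (inst 0 P a) (F a)) -> respects X F ->
    interp U (All A P) (truth (forall a, X a a -> inh (F a)))
| interp_Ex A P X F :
    interp U A X -> (forall a, X a a -> interp U (inst 0 P a) (F a)) -> respects X F ->
    interp U (Ex A P) (truth (exists a, X a a /\ inh (F a)))
| interp_PEq A a b X :
    A <> Pow1 -> interp U A X -> X a a -> X b b -> interp U (PEq A a b) (truth (X a b))
| interp_PEqPow1 u v X Y :
    interp U (Dec u) X -> interp U (Dec v) Y -> interp U (PEq Pow1 u v) (truth (X = Y))
| interp_Dec p v P X : red p v -> decode v = Some P -> interp U P X -> interp U (Dec p) X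
| interp_orc p t : red p (App oracle t) -> interp U (Dec p) (truth (orc_true t)).

Definition propR : rel := fun p q =>
  exists X, irrelevant X /\ interp None (Dec p) X /\ interp None (Dec q) X.

Definition coll : option rel := Some propR.

Lemma interp_mono A X : interp None A X -> forall U, interp U A X.
Proof. induction 1; intros V; try discriminate; eauto using interp. Qed.

Lemma decode_step v P : decode v = Some P -> step v = None.
Proof. destruct v; intros H; try discriminate H; reflexivity. Qed.

Lemma interp_saturated U A X : (forall R, U = Some R -> saturated R) -> interp U A X -> saturated X.
Proof.
  intros HU; induction 1; auto using saturated_truth, saturated_listR, saturated_sigR,
      saturated_piR, saturated_plusR, saturated_quotR.
Qed.

(** For each form of type one clause applies, and the evaluation that the clauses for
    [Dec] refer to is deterministic.  Equal relations are identified, by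
    extensionality. *)
Lemma interp_unique U A X : (forall R, U = Some R -> saturated R) ->
  interp U A X -> forall Y, interp U A Y -> X = Y.
Proof.
  intros HU H; induction H; intros Z HZ; inversion HZ; subst; try congruence;
    repeat match goal with
    | IH : forall Y, interp U ?A Y -> ?X = Y, H : interp U ?A ?X' |- _ =>
        tryif constr_eq X X' then fail else (apply IH in H; subst X')
    end; try reflexivity; try congruence.
  - apply sigR_ext; eauto using interp_saturated.
  - apply piR_ext; eauto using interp_saturated.
  - apply quotR_ext; eauto.
  - assert (E : forall a, X a a -> F a = F0 a) by eauto.
    apply truth_ext; split; intros Q a Ka; [rewrite <- E|rewrite E]; auto.
  - assert (E : forall a, X a a -> F a = F0 a) by eauto.
    apply truth_ext; split; intros (a & Ka & Q); exists a; (split; [auto|]);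
      [rewrite <- E|rewrite E]; auto.
  - assert (v = v0) by eauto using red_det, decode_step; subst v0.
    assert (P = P0) by congruence; subst P0; auto.
  - assert (v = App oracle t) by eauto using red_det, decode_step; subst; discriminate.
  - assert (v = App oracle t) by eauto using red_det, decode_step; subst; discriminate.
  - assert (E : App oracle t = App oracle t0) by (eapply red_det; eauto).
    injection E as ->; reflexivity.
Qed.

Lemma interp_Dec_step U p q X : step p = Some q -> (interp U (Dec p) X <-> interp U (Dec q) X).
Proof.
  intros E; split; intros H; inversion H; subst; eauto using interp, red;
    [eapply interp_Dec|eapply interp_orc]; eauto; eapply red_back; eauto using decode_step.
Qed.

Lemma small_unique A X Y : interp None A X -> interp None A Y -> X = Y.
Proof. intros H H'; eapply (interp_unique None); eauto; discriminate. Qed.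

Lemma saturated_propR : saturated propR.
Proof.
  split.
  - intros t u (X & I & ? & ?); exists X; auto.
  - intros t u v (X & I & ? & H) (Y & J & H' & ?).
    rewrite (small_unique _ _ _ H' H) in *. exists X; auto.
  - intros t t' u E; split; intros (X & I & ? & ?); exists X; repeat split; auto;
      apply (interp_Dec_step None _ _ X E); auto.
Qed.

Lemma coll_level_saturated : forall R, coll = Some R -> saturated R.
Proof. intros R [= <-]; apply saturated_propR. Qed.

(** * Semantic judgements *)

(** Propositions and sets are interpreted at the same two levels; propositions are the
    types whose relation is [irrelevant], which makes all cumulativity rules evident. *)
Definition level (k : kind) : option rel :=
  match k with prop_s | set => None | prop | col => coll end.

Definition isprop (k : kind) : Prop := k = prop_s \/ k = prop.

Definition interp_kind (k : kind) (A : exp) (X : rel) : Prop := interp (level k) A X /\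
    (isprop k -> irrelevant X).

(** Two substitutions are related when they assign equal elements to the variables of
    the context.  Variables outside of the context are unconstrained, hence
    no closed expressions are needed anywhere. *)
Definition env_rel (Γ : ctx) (s s' : nat -> exp) : Prop :=
  forall n A, nth_error Γ n = Some A ->
    exists X, interp coll (subst s (wk (S n) A)) X /\ interp coll (subst s' (wk (S n) A)) X /\
        X (s n) (s' n).

(** Typehood and elementhood are the diagonal cases [tyeq Γ A A k] and [tmeq Γ a a A]:
    a well formed type has the same denotation under related substitutions. *)
Definition tyeq (Γ : ctx) (A B : exp) (k : kind) : Prop :=
  forall s s', env_rel Γ s s' -> exists X, interp_kind k (subst s A) X /\
      interp_kind k (subst s' B) X.

Definition tmeq (Γ : ctx) (a b A : exp) : Prop :=
  forall s s', env_rel Γ s s' ->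
    exists X, interp coll (subst s A) X /\ interp coll (subst s' A) X /\
        X (subst s a) (subst s' b).

Fixpoint ctx_ok (Γ : ctx) : Prop :=
  match Γ with [] => True | A :: Γ => ctx_ok Γ /\ tyeq Γ A A col end.

Lemma interp_kind_coll k A X : interp_kind k A X -> interp coll A X.
Proof. intros [H _]; destruct k; simpl in H; eauto using interp_mono. Qed.

Lemma interp_kind_kle k k' A X : kle k k' -> interp_kind k A X -> interp_kind k' A X.
Proof.
  intros H [H1 H2]; split; destruct H; simpl in *; eauto using interp_mono; unfold isprop in *;
    intros [E|E]; try discriminate; auto.
Qed.

Lemma coll_unique A X Y : interp coll A X -> interp coll A Y -> X = Y.
Proof. intros H H'; eapply interp_unique; eauto using coll_level_saturated. Qed.

Lemma coll_saturated A X : interp coll A X -> saturated X.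
Proof. apply interp_saturated, coll_level_saturated. Qed.

Lemma interp_kind_unique k k' A X Y : interp_kind k A X -> interp_kind k' A Y -> X = Y.
Proof. eauto using coll_unique, interp_kind_coll. Qed.

Lemma env_sym Γ s s' : env_rel Γ s s' -> env_rel Γ s' s.
Proof.
  intros H n A E; destruct (H n A E) as (X & H1 & H2 & H3).
  exists X; repeat split; auto; apply saturated_sym; eauto using coll_saturated.
Qed.

Lemma env_refl Γ s s' : env_rel Γ s s' -> env_rel Γ s s.
Proof.
  intros H n A E; destruct (H n A E) as (X & H1 & H2 & H3).
  exists X; repeat split; auto; eapply saturated_refl_l; eauto using coll_saturated.
Qed.

Lemma env_refl' Γ s s' : env_rel Γ s s' -> env_rel Γ s' s'.
Proof. intros H; eapply env_refl, env_sym, H. Qed.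

Lemma env_cons Γ A X s s' a a' :
  env_rel Γ s s' -> interp coll (subst s A) X -> interp coll (subst s' A) X -> X a a' ->
  env_rel (A :: Γ) (scons a s) (scons a' s').
Proof.
  intros H H1 H2 H3 [|n] B E; simpl in E.
  - injection E as <-; exists X; rewrite !subst_wk; auto.
  - destruct (H n B E) as (Y & HY); exists Y; rewrite !subst_wk in *; exact HY.
Qed.

Lemma tyeq_sym Γ A B k : tyeq Γ A B k -> tyeq Γ B A k.
Proof. intros H s s' C; destruct (H s' s (env_sym _ _ _ C)) as (X & ? & ?); eauto. Qed.

Lemma tyeq_trans Γ A B C k : tyeq Γ A B k -> tyeq Γ B C k -> tyeq Γ A C k.
Proof.
  intros H H' s s' Hs. destruct (H s s (env_refl _ _ _ Hs)) as (X & ? & ?).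
  destruct (H' s s' Hs) as (Y & ? & ?). assert (X = Y) by eauto using interp_kind_unique; subst;
      eauto.
Qed.

Lemma tyeq_kle Γ A B k k' : kle k k' -> tyeq Γ A B k -> tyeq Γ A B k'.
Proof. intros E H s s' Hs; destruct (H s s' Hs) as (X & ? & ?); eauto using interp_kind_kle. Qed.

Lemma tyeq_col Γ A B k : tyeq Γ A B k -> tyeq Γ A B col.
Proof.
  intros H s s' Hs; destruct (H s s' Hs) as (X & H1 & H2); exists X;
      apply interp_kind_coll in H1, H2.
  split; split; auto; intros [|]; discriminate.
Qed.

(** Comparing the substitutions with themselves as well, all four types turn out to
    have the same denotation. *)
Lemma tyeq_at Γ A B k s s' : tyeq Γ A B k -> env_rel Γ s s' ->
  exists X, interp_kind k (subst s A) X /\ interp_kind k (subst s' A) X /\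
      interp_kind k (subst s B) X /\ interp_kind k (subst s' B) X.
Proof.
  intros H Hs. destruct (H s s' Hs) as (X & ? & ?).
  destruct (H s s (env_refl _ _ _ Hs)) as (Y & ? & ?).
  destruct (H s' s' (env_refl' _ _ _ Hs)) as (Z & ? & ?).
  assert (X = Y) by eauto using interp_kind_unique; subst Y.
  assert (X = Z) by eauto using interp_kind_unique; subst Z. eauto 6.
Qed.

Lemma tmeq_sym Γ a b A : tmeq Γ a b A -> tmeq Γ b a A.
Proof.
  intros H s s' Hs; destruct (H s' s (env_sym _ _ _ Hs)) as (X & ? & ? & ?); exists X.
  repeat split; auto; apply saturated_sym; eauto using coll_saturated.
Qed.

Lemma tmeq_trans Γ a b c A : tmeq Γ a b A -> tmeq Γ b c A -> tmeq Γ a c A.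
Proof.
  intros H H' s s' Hs; destruct (H s s (env_refl _ _ _ Hs)) as (X & ? & ? & ?).
  destruct (H' s s' Hs) as (Y & ? & ? & ?).
  assert (X = Y) by eauto using coll_unique; subst Y.
  exists X; repeat split; auto; eapply saturated_trans; eauto using coll_saturated.
Qed.

Lemma tmeq_refl Γ a b A : tmeq Γ a b A -> tmeq Γ a a A.
Proof. intros H; eapply tmeq_trans; [|apply tmeq_sym]; eassumption. Qed.

Lemma tmeq_refl' Γ a b A : tmeq Γ a b A -> tmeq Γ b b A.
Proof. intros H; eapply tmeq_trans; [apply tmeq_sym|]; eassumption. Qed.

Lemma tmeq_conv Γ a b A B : tmeq Γ a b A -> tyeq Γ A B col -> tmeq Γ a b B.
Proof.
  intros H E s s' Hs; destruct (H s s' Hs) as (X & ? & ? & ?).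
  destruct (tyeq_at _ _ _ _ _ _ E Hs) as (Y & K1 & K2 & K3 & K4); apply interp_kind_coll in K1,
      K2, K3, K4.
  assert (X = Y) by eauto using coll_unique; subst; eauto.
Qed.

Lemma tmeq_at Γ a b A s s' X : tmeq Γ a b A -> env_rel Γ s s' -> interp coll (subst s A) X ->
  interp coll (subst s' A) X /\ X (subst s a) (subst s' a) /\ X (subst s b) (subst s' b) /\
  X (subst s a) (subst s b) /\ X (subst s a) (subst s' b) /\ X (subst s' a) (subst s' b).
Proof.
  assert (Q : forall a b, tmeq Γ a b A -> forall s s' Y, env_rel Γ s s' ->
      interp coll (subst s A) Y -> interp coll (subst s' A) Y /\ Y (subst s a) (subst s' b)).
  { intros c d H t t' Y Ht HY; destruct (H t t' Ht) as (Z & ? & ? & ?).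
    assert (Y = Z) by eauto using coll_unique; subst Z; auto. }
  intros H Hs HX.
  destruct (Q _ _ H _ _ _ Hs HX) as [HX' ?].
  destruct (Q _ _ (tmeq_refl _ _ _ _ H) _ _ _ Hs HX) as [_ ?].
  destruct (Q _ _ (tmeq_refl' _ _ _ _ H) _ _ _ Hs HX) as [_ ?].
  destruct (Q _ _ H _ _ _ (env_refl _ _ _ Hs) HX) as [_ ?].
  destruct (Q _ _ H _ _ _ (env_refl' _ _ _ Hs) HX') as [_ ?]. repeat split; auto.
Qed.

(** * Families and substitution *)

(** A dependent type yields a semantic family that serves both substitutions and both
    types.  No choice is needed to obtain it: the denotation is unique, so [F a] can
    be defined as the union of all denotations. *)
Lemma family Γ A B B' k s s' X :
  tyeq (A :: Γ) B B' k -> env_rel Γ s s' -> interp coll (subst s A) X ->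
      interp coll (subst s' A) X ->
  exists F, respects X F /\ forall a, X a a ->
    interp_kind k (subst (scons a s) B) (F a) /\ interp_kind k (subst (scons a s') B) (F a) /\
    interp_kind k (subst (scons a s) B') (F a) /\ interp_kind k (subst (scons a s') B') (F a).
Proof.
  intros H Hs H1 H2.
  set (F := fun a t u => exists Y, interp_kind k (subst (scons a s) B) Y /\ Y t u).
  assert (EF : forall a Y, interp_kind k (subst (scons a s) B) Y -> F a = Y).
  { intros a Y HY; apply rel_ext; intros t u; split; [|exists Y; auto].
    intros (Z & HZ & ?); assert (Y = Z) by eauto using interp_kind_unique; subst; auto. }
  exists F; split.
  - intros a b Hab. destruct (tyeq_at _ _ _ _ (scons a s) (scons b s) H) as (Y & ? & ? & ? & ?).
    { eapply env_cons; eauto using env_refl. }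
    rewrite (EF a Y), (EF b Y); auto.
  - intros a Ha. destruct (tyeq_at _ _ _ _ (scons a s) (scons a s') H) as (Y & ? & ? & ? & ?).
    { eapply env_cons; eauto. }
    rewrite (EF a Y); auto.
Qed.

(** It is enough to know the types under the first substitution: when the context is
    well formed, they denote the same relations under the second one. *)
Lemma env_intro Δ σ τ : ctx_ok Δ ->
  (forall n A, nth_error Δ n = Some A ->
     exists X, interp coll (subst σ (wk (S n) A)) X /\ X (σ n) (τ n)) ->
  env_rel Δ σ τ.
Proof.
  revert σ τ; induction Δ as [|A Δ IH]; intros σ τ V H; [intros [|n] ? [=]|].
  destruct V as [V VA].
  assert (C : env_rel Δ (fun n => σ (S n)) (fun n => τ (S n))).
  { apply IH; auto. intros n B E; destruct (H (S n) B E) as (X & ? & ?).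
    exists X; rewrite subst_wk in *; auto. }
  intros [|n] B E; simpl in E.
  - injection E as <-. destruct (H 0 A eq_refl) as (X & H1 & H2).
    destruct (VA _ _ C) as (Y & H3 & H4); apply interp_kind_coll in H3, H4.
    rewrite subst_wk in H1. assert (X = Y) by eauto using coll_unique; subst Y.
    exists X; rewrite !subst_wk; auto.
  - destruct (C n B E) as (X & HX); exists X; rewrite !subst_wk in *; exact HX.
Qed.

Lemma env_comp Γ Δ σ τ s s' : ctx_ok Δ ->
  (forall n A, nth_error Δ n = Some A -> tmeq Γ (σ n) (τ n) (subst σ (wk (S n) A))) ->
  env_rel Γ s s' -> env_rel Δ (fun n => subst s (σ n)) (fun n => subst s' (τ n)).
Proof.
  intros V H Hs; apply env_intro; auto; intros n A E.
  destruct (H n A E s s' Hs) as (X & H1 & H2 & H3); exists X.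
  rewrite subst_subst in H1; auto.
Qed.

Lemma tyeq_subst Γ Δ σ τ A B k : ctx_ok Δ ->
  (forall n A, nth_error Δ n = Some A -> tmeq Γ (σ n) (τ n) (subst σ (wk (S n) A))) ->
  tyeq Δ A B k -> tyeq Γ (subst σ A) (subst τ B) k.
Proof.
  intros V H HA s s' Hs; rewrite !subst_subst; apply HA; eauto using env_comp.
Qed.

Lemma tmeq_subst Γ Δ σ τ a b A : ctx_ok Δ ->
  (forall n A, nth_error Δ n = Some A -> tmeq Γ (σ n) (τ n) (subst σ (wk (S n) A))) ->
  tmeq Δ a b A -> tmeq Γ (subst σ a) (subst τ b) (subst σ A).
Proof.
  intros V H HA s s' Hs.
  destruct (HA _ _ (env_comp _ _ _ _ _ _ V H Hs)) as (X & H1 & H2 & H3).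
  assert (H' : forall n A, nth_error Δ n = Some A -> tmeq Γ (σ n) (σ n) (subst σ (wk (S n) A)))
    by eauto using tmeq_refl.
  destruct (HA _ _ (env_comp _ _ _ _ _ _ V H' Hs)) as (Y & H4 & H5 & H6).
  assert (X = Y) by eauto using coll_unique; subst Y.
  exists X; rewrite !subst_subst; auto.
Qed.

Lemma tmeq_var Γ n A : nth_error Γ n = Some A -> tmeq Γ (Var n) (Var n) (wk (S n) A).
Proof. intros E s s' Hs; exact (Hs n A E). Qed.

Lemma saturated_expand X t t' u u' : saturated X -> red t t' -> red u u' -> X t' u' -> X t u.
Proof. intros W H H' HX; apply (saturated_red X t t'), (saturated_red_r X u u'); auto. Qed.

Ltac norm :=
  cbn [subst]; rewrite ?subst_inst, ?subst_inst2, ?subst_inst3, ?inst_up, ?inst2_up, ?inst3_up,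
    ?subst_wk; cbn [subst Nat.add scons].
Ltac norm_in H :=
  cbn [subst] in H;
  rewrite ?subst_inst, ?subst_inst2, ?subst_inst3, ?inst_up, ?inst2_up, ?inst3_up,
    ?subst_wk in H; cbn [subst Nat.add scons] in H.

Ltac interp_at H Hs X :=
  destruct (tyeq_at _ _ _ _ _ _ H Hs) as (X & ?Ty & ?Ty & ?Ty & ?Ty).

Ltac to_coll :=
  repeat match goal with
  | H : interp_kind ?k ?A ?X |- _ =>
      lazymatch goal with
      | _ : interp coll A X |- _ => fail
      | _ => pose proof (interp_kind_coll _ _ _ H)
      end
  end.

(** * Formation of types *)

Lemma interp_kind_intro k A X : interp (level k) A X -> ~ isprop k \/ irrelevant X ->
    interp_kind k A X.
Proof. intros H [H'|H']; split; tauto. Qed.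

Lemma set_not_prop : ~ isprop set. Proof. intros [|]; discriminate. Qed.
Lemma col_not_prop : ~ isprop col. Proof. intros [|]; discriminate. Qed.
Lemma typ_not_prop i : ~ isprop (typ i).
Proof. destruct i; [apply set_not_prop|apply col_not_prop]. Qed.
Lemma level_typ i : level (typ i) = level (prp i). Proof. destruct i; reflexivity. Qed.

Lemma tyeq_const Γ C X k : (forall s, subst s C = C) -> interp (level k) C X ->
  ~ isprop k \/ irrelevant X -> tyeq Γ C C k.
Proof. intros E H I s s' _; exists X; rewrite !E; split; apply interp_kind_intro; eauto. Qed.

Lemma tyeq_List Γ A A' : tyeq Γ A A' set -> tyeq Γ (List A) (List A') set.
Proof.
  intros H s s' Hs; interp_at H Hs X; exists (listR X).
  split; (apply interp_kind_intro; [|left; apply set_not_prop]); constructor;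
      [apply Ty|apply Ty2].
Qed.

Lemma tyeq_Plus Γ A A' B B' :
  tyeq Γ A A' set -> tyeq Γ B B' set -> tyeq Γ (Plus A B) (Plus A' B') set.
Proof.
  intros H H' s s' Hs; interp_at H Hs X; interp_at H' Hs Y; exists (plusR X Y).
  split; (apply interp_kind_intro; [|left; apply set_not_prop]); constructor;
    [apply Ty|apply Ty3|apply Ty2|apply Ty6].
Qed.

(** The common argument for the type formers [C] that bind a variable, where [cR] is
    the corresponding operation on relations. *)
Lemma tyeq_bind Γ A A' B B' k k' (C : exp -> exp -> exp) (cR : rel -> (exp -> rel) -> rel) :
  (forall s A B, subst s (C A B) = C (subst s A) (subst (up s) B)) ->
  (forall A B X F, interp (level k) A X -> (forall a, X a a ->
      interp (level k) (inst 0 B a) (F a)) ->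
     respects X F -> interp (level k) (C A B) (cR X F)) ->
  level k' = level k ->
  ~ isprop k \/ (forall X F, irrelevant (cR X F)) ->
  tyeq Γ A A' k' -> tyeq (A :: Γ) B B' k -> tyeq Γ (C A B) (C A' B') k.
Proof.
  intros EC HC Ek I H H' s s' Hs; interp_at H Hs X.
  destruct (family _ _ _ _ _ s s' X H' Hs) as (F & R & HF); [apply interp_kind_coll in Ty;
      auto..|apply interp_kind_coll in Ty0; auto|].
  exists (cR X F); rewrite !EC; split; (apply interp_kind_intro; [|destruct I; auto]); apply HC;
      auto;
    try (rewrite <- Ek; first [apply Ty|apply Ty2]);
    intros a Ha; rewrite inst_up; apply HF; auto.
Qed.

Lemma tyeq_Sig Γ A A' B B' i :
  tyeq Γ A A' (typ i) -> tyeq (A :: Γ) B B' (typ i) -> tyeq Γ (Sig A B) (Sig A' B') (typ i).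
Proof. apply tyeq_bind with (cR := sigR); auto using interp_Sig, typ_not_prop. Qed.

Lemma tyeq_Pi Γ A A' B B' k : ~ isprop k ->
  tyeq Γ A A' k -> tyeq (A :: Γ) B B' k -> tyeq Γ (Pi A B) (Pi A' B') k.
Proof. intros N; apply tyeq_bind with (cR := piR); auto using interp_Pi. Qed.

Lemma tyeq_All Γ A A' B B' i :
  tyeq Γ A A' (typ i) -> tyeq (A :: Γ) B B' (prp i) -> tyeq Γ (All A B) (All A' B') (prp i).
Proof.
  apply tyeq_bind with (cR := fun X F => truth (forall a, X a a -> inh (F a)));
    auto using interp_All, level_typ, irrelevant_truth.
Qed.

Lemma tyeq_Ex Γ A A' B B' i :
  tyeq Γ A A' (typ i) -> tyeq (A :: Γ) B B' (prp i) -> tyeq Γ (Ex A B) (Ex A' B') (prp i).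
Proof.
  apply tyeq_bind with (cR := fun X F => truth (exists a, X a a /\ inh (F a)));
    auto using interp_Ex, level_typ, irrelevant_truth.
Qed.

Lemma tyeq_conn Γ P P' Q Q' k (C : exp -> exp -> exp) (c : Prop -> Prop -> Prop) :
  (forall s A B, subst s (C A B) = C (subst s A) (subst s B)) ->
  (forall P Q X Y, interp (level k) P X -> interp (level k) Q Y ->
      interp (level k) (C P Q) (truth (c (inh X) (inh Y)))) ->
  tyeq Γ P P' k -> tyeq Γ Q Q' k -> tyeq Γ (C P Q) (C P' Q') k.
Proof.
  intros EC HC H H' s s' Hs; interp_at H Hs X; interp_at H' Hs Y;
      exists (truth (c (inh X) (inh Y))).
  rewrite !EC; split; (apply interp_kind_intro; [|right; apply irrelevant_truth]); apply HC;
    [apply Ty|apply Ty3|apply Ty2|apply Ty6].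
Qed.

Lemma tyeq_And Γ P P' Q Q' k : tyeq Γ P P' k -> tyeq Γ Q Q' k -> tyeq Γ (And P Q) (And P' Q') k.
Proof. apply tyeq_conn with (c := and); auto using interp_And. Qed.
Lemma tyeq_Or Γ P P' Q Q' k : tyeq Γ P P' k -> tyeq Γ Q Q' k -> tyeq Γ (Or P Q) (Or P' Q') k.
Proof. apply tyeq_conn with (c := or); auto using interp_Or. Qed.
Lemma tyeq_Imp Γ P P' Q Q' k : tyeq Γ P P' k -> tyeq Γ Q Q' k -> tyeq Γ (Imp P Q) (Imp P' Q') k.
Proof. apply tyeq_conn with (c := fun P Q => P -> Q); auto using interp_Imp. Qed.

(** The general clause for equality is correct also for P(1): the truth values coded by
    two elements are equal exactly when the elements are related. *)
Lemma interp_eq k A X a b : interp (level k) A X -> X a a -> X b b ->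
    interp (level k) (PEq A a b) (truth (X a b)).
Proof.
  intros H Ha Hb.
  destruct (classic (A = Pow1)) as [->|N]; [|apply interp_PEq; auto].
  inversion H as [|? E| | | | | | | | | | | | | | | | |]; subst.
  destruct k; try discriminate; injection E as <-;
  destruct Ha as (Xa & Ia & Ha & _), Hb as (Xb & Ib & Hb & _);
  (replace (truth (propR a b)) with (truth (Xa = Xb));
    [apply interp_PEqPow1; apply interp_mono; auto|]);
  (apply truth_ext; split; [intros <-; exists Xa; auto|]);
  intros (Y & I & H1 & H2);
  rewrite (small_unique _ _ _ Ha H1), (small_unique _ _ _ Hb H2); reflexivity.
Qed.

Lemma tyeq_PEq Γ A A' a a' b b' i :
  tyeq Γ A A' (typ i) -> tmeq Γ a a' A -> tmeq Γ b b' A ->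
  tyeq Γ (PEq A a b) (PEq A' a' b') (prp i).
Proof.
  intros H Ha Hb s s' Hs; interp_at H Hs X; to_coll.
  destruct (tmeq_at _ _ _ _ _ _ _ Ha Hs ltac:(eauto)) as (_ & ? & ? & ? & ? & ?).
  destruct (tmeq_at _ _ _ _ _ _ _ Hb Hs ltac:(eauto)) as (_ & ? & ? & ? & ? & ?).
  assert (W : saturated X) by eauto using coll_saturated.
  exists (truth (X (subst s a) (subst s b))); split;
    (apply interp_kind_intro; [|right; apply irrelevant_truth]); rewrite <- level_typ;
        cbn [subst].
  - apply interp_eq; [apply Ty| |]; by_per.
  - replace (truth (X (subst s a) (subst s b))) with (truth (X (subst s' a') (subst s' b'))).
    + apply interp_eq; [apply Ty2| |]; by_per.
    + apply truth_ext; split; intros Q.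
      * apply (saturated_trans X W) with (subst s' b'); [|by_per].
        apply (saturated_trans X W) with (subst s' a'); auto.
      * apply (saturated_trans X W) with (subst s b); [|by_per].
        apply (saturated_trans X W) with (subst s a); by_per.
Qed.

(** * Truth of propositions *)

(** One substitution is enough, and no proof term occurs, because propositions denote
    total or empty relations. *)
Definition holds (Γ : ctx) (P : exp) : Prop :=
  forall s X, env_rel Γ s s -> interp coll (subst s P) X -> inh X.

Lemma holds_of_tmeq Γ a b P : tyeq Γ P P prop -> tmeq Γ a b P -> holds Γ P.
Proof.
  intros HP H s X Hs HX. interp_at HP Hs Y; to_coll.
  destruct (tmeq_at _ _ _ _ _ _ _ H Hs HX) as (_ & Q & _).
  assert (X = Y) by eauto using coll_unique; subst X.
  eapply (proj2 Ty); [right; reflexivity|exact Q].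
Qed.

Lemma tmeq_of_holds Γ a b P : tyeq Γ P P prop -> holds Γ P -> tmeq Γ a b P.
Proof.
  intros HP H s s' Hs. interp_at HP Hs Y; to_coll.
  exists Y; repeat split; auto. eapply (proj2 Ty); [right; reflexivity|].
  apply (H s); eauto using env_refl.
Qed.

Lemma holds_And Γ P Q : tyeq Γ P P prop -> tyeq Γ Q Q prop ->
  holds Γ (And P Q) <-> holds Γ P /\ holds Γ Q.
Proof.
  intros HP HQ.
  assert (E : forall s, env_rel Γ s s -> exists X Y, interp coll (subst s P) X /\
      interp coll (subst s Q) Y /\
     interp coll (subst s (And P Q)) (truth (inh X /\ inh Y))).
  { intros s Hs; interp_at HP Hs X; interp_at HQ Hs Y; to_coll; exists X, Y; repeat split; auto.
    apply interp_And; auto. }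
  split.
  - intros H; split; intros s Z Hs HZ; destruct (E s Hs) as (X & Y & HX & HY & HXY);
      apply (H s _ Hs) in HXY; destruct HXY;
      [rewrite (coll_unique _ _ _ HZ HX)|rewrite (coll_unique _ _ _ HZ HY)]; auto.
  - intros [H H'] s Z Hs HZ; destruct (E s Hs) as (X & Y & HX & HY & HXY).
    rewrite (coll_unique _ _ _ HZ HXY); split; eauto.
Qed.

Lemma holds_Bot Γ P : holds Γ Bot -> holds Γ P.
Proof. intros H s X Hs _; destruct (H s (truth False) Hs); constructor. Qed.

Lemma holds_Or1 Γ P Q : tyeq Γ P P prop -> tyeq Γ Q Q prop -> holds Γ P -> holds Γ (Or P Q).
Proof.
  intros HP HQ H s Z Hs HZ; interp_at HP Hs X; interp_at HQ Hs Y; to_coll.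
  rewrite (coll_unique _ _ (truth (inh X \/ inh Y)) HZ); [left; eauto|apply interp_Or; auto].
Qed.

Lemma holds_Or2 Γ P Q : tyeq Γ P P prop -> tyeq Γ Q Q prop -> holds Γ Q -> holds Γ (Or P Q).
Proof.
  intros HP HQ H s Z Hs HZ; interp_at HP Hs X; interp_at HQ Hs Y; to_coll.
  rewrite (coll_unique _ _ (truth (inh X \/ inh Y)) HZ); [right; eauto|apply interp_Or; auto].
Qed.

Lemma holds_ext Γ P Q s : holds (P :: Γ) (wk 1 Q) -> env_rel Γ s s ->
  forall X Y, interp coll (subst s P) X -> interp coll (subst s Q) Y -> inh X -> inh Y.
Proof.
  intros H Hs X Y HX HY TX; apply (H (scons Tru s)).
  - eapply env_cons; eauto.
  - norm; exact HY.
Qed.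

Lemma holds_Or_elim Γ P Q M : tyeq Γ P P prop -> tyeq Γ Q Q prop ->
  holds Γ (Or P Q) -> holds (P :: Γ) (wk 1 M) -> holds (Q :: Γ) (wk 1 M) -> holds Γ M.
Proof.
  intros HP HQ H H1 H2 s Z Hs HZ; interp_at HP Hs X; interp_at HQ Hs Y; to_coll.
  assert (T : inh X \/ inh Y) by (apply (H s (truth (inh X \/ inh Y)) Hs), interp_Or; auto).
  destruct T; eauto using holds_ext.
Qed.

Lemma holds_Imp Γ P Q : tyeq Γ P P prop -> tyeq Γ Q Q prop ->
  holds (P :: Γ) (wk 1 Q) -> holds Γ (Imp P Q).
Proof.
  intros HP HQ H s Z Hs HZ; interp_at HP Hs X; interp_at HQ Hs Y; to_coll.
  rewrite (coll_unique _ _ (truth (inh X -> inh Y)) HZ); [|apply interp_Imp; auto].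
  intros T; eauto using holds_ext.
Qed.

Lemma holds_mp Γ P Q : tyeq Γ P P prop -> tyeq Γ Q Q prop ->
  holds Γ (Imp P Q) -> holds Γ P -> holds Γ Q.
Proof.
  intros HP HQ H H' s Z Hs HZ; interp_at HP Hs X; interp_at HQ Hs Y; to_coll.
  assert (T : inh X -> inh Y) by (apply (H s (truth (inh X -> inh Y)) Hs), interp_Imp; auto).
  rewrite (coll_unique _ _ Y HZ); eauto.
Qed.

Lemma bind_at Γ A P k s : tyeq Γ A A col -> tyeq (A :: Γ) P P k -> env_rel Γ s s ->
  exists X F, interp coll (subst s A) X /\ respects X F /\
    forall a, X a a -> interp coll (subst (scons a s) P) (F a) /\
        env_rel (A :: Γ) (scons a s) (scons a s).
Proof.
  intros HA HP Hs; interp_at HA Hs X; to_coll.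
  destruct (family _ _ _ _ _ s s X HP Hs) as (F & R & HF); auto.
  exists X, F; repeat split; auto; [eapply interp_kind_coll; apply HF; auto|eapply env_cons;
      eauto].
Qed.

Lemma holds_All Γ A P : tyeq Γ A A col -> tyeq (A :: Γ) P P prop ->
  holds (A :: Γ) P -> holds Γ (All A P).
Proof.
  intros HA HP H s Z Hs HZ. destruct (bind_at _ _ _ _ s HA HP Hs) as (X & F & HX & R & HF).
  rewrite (coll_unique _ _ (truth (forall a, X a a -> inh (F a))) HZ).
  - intros a Ha; destruct (HF a Ha); eauto.
  - apply interp_All; auto; intros a Ha; norm; apply HF; auto.
Qed.

Lemma holds_All_elim Γ A P a : tyeq Γ A A col -> tyeq (A :: Γ) P P prop ->
  holds Γ (All A P) -> tmeq Γ a a A -> holds Γ (inst 0 P a).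
Proof.
  intros HA HP H Ta s Z Hs HZ. destruct (bind_at _ _ _ _ s HA HP Hs) as (X & F & HX & R & HF).
  assert (T : forall a, X a a -> inh (F a)).
  { apply (H s (truth (forall a, X a a -> inh (F a))) Hs), interp_All; auto.
    intros b Hb; norm; apply HF; auto. }
  destruct (tmeq_at _ _ _ _ _ _ _ Ta Hs HX) as (_ & Q & _).
  norm_in HZ. rewrite (coll_unique _ _ (F (subst s a)) HZ); [auto|]. apply HF; auto.
Qed.

Lemma holds_Ex Γ A P a : tyeq Γ A A col -> tyeq (A :: Γ) P P prop ->
  tmeq Γ a a A -> holds Γ (inst 0 P a) -> holds Γ (Ex A P).
Proof.
  intros HA HP Ta H s Z Hs HZ. destruct (bind_at _ _ _ _ s HA HP Hs) as (X & F & HX & R & HF).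
  destruct (tmeq_at _ _ _ _ _ _ _ Ta Hs HX) as (_ & Q & _).
  rewrite (coll_unique _ _ (truth (exists a, X a a /\ inh (F a))) HZ).
  - exists (subst s a); split; auto. apply (H s); auto. norm. apply HF; auto.
  - apply interp_Ex; auto; intros b Hb; norm; apply HF; auto.
Qed.

Lemma holds_Ex_elim Γ A P M : tyeq Γ A A col -> tyeq (A :: Γ) P P prop ->
  holds Γ (Ex A P) -> holds (P :: A :: Γ) (wk 2 M) -> holds Γ M.
Proof.
  intros HA HP H H' s Z Hs HZ. destruct (bind_at _ _ _ _ s HA HP Hs) as (X & F & HX & R & HF).
  assert (T : exists a, X a a /\ inh (F a)).
  { apply (H s (truth (exists a, X a a /\ inh (F a))) Hs), interp_Ex; auto.
    intros b Hb; norm; apply HF; auto. }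
  destruct T as (a & Ha & T); destruct (HF a Ha) as [H1 H2].
  apply (H' (scons Tru (scons a s))).
  - eapply env_cons; eauto.
  - norm; exact HZ.
Qed.

(** Propositional and judgemental equality coincide in the model, whence the reflection
    rule of emTT. *)
Lemma holds_PEq Γ A a b : tyeq Γ A A col -> tmeq Γ a a A -> tmeq Γ b b A ->
  (holds Γ (PEq A a b) <-> tmeq Γ a b A).
Proof.
  intros HA Ha Hb.
  assert (E : forall s X, env_rel Γ s s -> interp coll (subst s A) X ->
     interp coll (subst s (PEq A a b)) (truth (X (subst s a) (subst s b)))).
  { intros s X Hs HX; apply (interp_eq col); auto;
      [apply (tmeq_at _ _ _ _ _ _ _ Ha Hs HX)|apply (tmeq_at _ _ _ _ _ _ _ Hb Hs HX)]. }
  split; intros H.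
  - intros s s' Hs; interp_at HA Hs X; to_coll; exists X; repeat split; auto.
    assert (T : X (subst s a) (subst s b)).
    { apply (H s (truth (X (subst s a) (subst s b)))); eauto using env_refl. }
    eapply saturated_trans; [eauto using coll_saturated|exact T|].
    apply (tmeq_at _ _ _ _ _ _ X Hb Hs); auto.
  - intros s Z Hs HZ; interp_at HA Hs X; to_coll.
    rewrite (coll_unique _ _ _ HZ (E s X Hs ltac:(auto))).
    apply (tmeq_at _ _ _ _ _ _ X H Hs); auto.
Qed.

Ltac one_step W :=
  eapply (saturated_expand _ _ _ _ _ W);
    [eapply red_step; [reflexivity|constructor]|eapply red_step; [reflexivity|constructor]|].

Lemma holds_Id_elim Γ A C a b : tyeq Γ A A col -> tyeq (wk 1 A :: A :: Γ) C C prop ->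
  tmeq Γ a b A -> holds (A :: Γ) (inst2 1 C (Var 0) (Var 0)) -> holds Γ (inst2 0 C a b).
Proof.
  intros HA HC Hab H s Z Hs HZ; interp_at HA Hs X; to_coll.
  destruct (tmeq_at _ _ _ _ _ _ X Hab Hs ltac:(auto)) as (_ & Ha & Hb & Q & _).
  assert (C1 : env_rel (A :: Γ) (scons (subst s a) s) (scons (subst s a) s))
    by (eapply env_cons; eauto).
  assert (C2 : env_rel (wk 1 A :: A :: Γ) (scons (subst s a) (scons (subst s a) s))
                 (scons (subst s b) (scons (subst s a) s))).
  { eapply env_cons; eauto; norm; auto. }
  interp_at HC C2 Y; to_coll. norm_in HZ.
  rewrite (coll_unique _ _ Y HZ); auto. apply (H _ _ C1); norm; auto.
Qed.

(** * Introduction and elimination of sets *)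

Lemma motive_at Γ C M s s' X :
  tyeq (C :: Γ) M M col -> env_rel Γ s s' -> interp coll (subst s C) X ->
      interp coll (subst s' C) X ->
  exists F, respects X F /\
    (forall c, X c c -> interp coll (subst (scons c s) M) (F c) /\
        interp coll (subst (scons c s') M) (F c)) /\
    (forall c, X c c -> saturated (F c)).
Proof.
  intros H Hs H1 H2. destruct (family _ _ _ _ _ s s' X H Hs H1 H2) as (F & R & HF).
  exists F; split; [exact R|split]; intros c Hc; destruct (HF c Hc) as (K1 & K2 & _);
    apply interp_kind_coll in K1, K2; eauto using coll_saturated.
Qed.

Lemma tmeq_ElEmpty Γ M a b : tmeq Γ a a Empty -> tmeq Γ (ElEmpty a) b (inst 0 M a).
Proof.
  intros H s s' Hs; destruct (tmeq_at _ _ _ _ _ _ (truth False) H Hs) as (_ & [] & _).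
  constructor.
Qed.

Lemma tmeq_ElUnit Γ M t c : tyeq (Unit :: Γ) M M col -> tmeq Γ c c (inst 0 M Star) ->
  tmeq Γ (ElUnit t c) c (inst 0 M t) /\ tmeq Γ (ElUnit t c) (ElUnit t c) (inst 0 M t).
Proof.
  intros HM Hc.
  assert (Q : tmeq Γ (ElUnit t c) c (inst 0 M t)).
  { intros s s' Hs.
    destruct (motive_at _ _ _ s s' (truth True) HM Hs) as (F & R & HF & WF); try constructor.
    exists (F (subst s t)); norm.
    assert (E : forall u v, F u = F v) by (intros; apply R; exact I).
    split; [apply HF; exact I|]. rewrite (E _ (subst s' t)) at 1. split; [apply HF; exact I|].
    eapply saturated_step; [apply WF; exact I|reflexivity|].
    apply (tmeq_at _ _ _ _ _ _ (F (subst s t)) Hc Hs). norm.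
    rewrite (E _ Star); apply HF; exact I. }
  split; eauto using tmeq_refl.
Qed.

Lemma interp_List_at Γ A s s' : tyeq Γ A A set -> env_rel Γ s s' ->
  exists X, interp_kind set (subst s A) X /\ interp_kind set (subst s' A) X /\
    interp coll (List (subst s A)) (listR X) /\ interp coll (List (subst s' A)) (listR X) /\
        saturated X.
Proof.
  intros H Hs; interp_at H Hs X; to_coll; exists X.
  refine (conj Ty (conj Ty0 (conj _ (conj _ _)))); eauto using interp_List, coll_saturated.
Qed.

Lemma tmeq_Nil Γ A : tyeq Γ A A set -> tmeq Γ Nil Nil (List A).
Proof.
  intros H s s' Hs; destruct (interp_List_at _ _ _ _ H Hs) as (X & _ & _ & ? & ? & _).
  exists (listR X); repeat split; auto; constructor 1; constructor.
Qed.

Lemma tmeq_Cons Γ A t t' a a' : tyeq Γ A A set ->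
  tmeq Γ t t' (List A) -> tmeq Γ a a' A -> tmeq Γ (Cons t a) (Cons t' a') (List A).
Proof.
  intros H Ht Ha s s' Hs; destruct (interp_List_at _ _ _ _ H Hs) as (X & K1 & K2 & ? & ? & _);
      to_coll.
  exists (listR X); repeat split; auto; econstructor 2; [constructor|constructor| |].
  - apply (tmeq_at _ _ _ _ _ _ (listR X) Ht Hs); auto.
  - apply (tmeq_at _ _ _ _ _ _ X Ha Hs); auto.
Qed.

(** By induction on the relation that lists denote.  Here, as in the other
    eliminators, the motive has the same value at an expression and at its weak head
    normal form, since these are equal elements; then both sides take one
    reduction step. *)
Lemma tmeq_ElList Γ A M t t' a a' l l' : tyeq Γ A A set -> tyeq (List A :: Γ) M M col ->
  tmeq Γ t t' (List A) -> tmeq Γ a a' (inst 0 M Nil) ->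
  tmeq (inst 2 M (Var 1) :: wk 1 A :: List A :: Γ) l l' (inst 3 M (Cons (Var 2) (Var 1))) ->
  tmeq Γ (ElList t a l) (ElList t' a' l') (inst 0 M t).
Proof.
  intros HA HM Ht Ha Hl s s' Hs; destruct (interp_List_at _ _ _ _ HA Hs) as
      (X & K1 & K2 & L1 & L2 & WX).
  to_coll. destruct (motive_at _ _ _ s s' (listR X) HM Hs) as (F & R & HF & WF); auto.
  destruct (tmeq_at _ _ _ _ _ _ (listR X) Ht Hs L1) as (_ & Qt & _ & _ & Qt' & _).
  assert (W : saturated (listR X)) by auto using saturated_listR.
  set (E := fun u => ElList u (subst s a) (subst (up (up (up s))) l)).
  set (E' := fun u => ElList u (subst s' a') (subst (up (up (up s'))) l')).
  assert (Q : forall u v, listR X u v -> F u (E u) (E' v)).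
  { intros u v Luv; induction Luv as [u v Hu Hv|u v u1 u2 v1 v2 Hu Hv Q1 IH Q2].
    - assert (E1 : F u = F Nil).
      { apply R. apply (saturated_red (listR X) _ _ _ W Hu). constructor 1; constructor. }
      assert (N : listR X Nil Nil) by (constructor 1; constructor).
      rewrite E1. apply (saturated_expand _ _ (E Nil) _ (E' Nil)); auto.
      1,2: apply (red_cong (fun u => ElList u _ _)); auto using step_ElList.
      apply (saturated_expand _ _ (subst s a) _ (subst s' a')); auto.
      1,2: eapply red_step; [reflexivity|constructor].
      apply (tmeq_at _ _ _ _ _ _ (F Nil) Ha Hs); norm; apply HF; auto.
    - assert (N : listR X (Cons u1 u2) (Cons v1 v2))
        by (econstructor 2; [constructor|constructor|eauto|eauto]).
      assert (E1 : F u = F (Cons u1 u2)).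
      { apply R. apply (saturated_red (listR X) _ _ _ W Hu). by_per. }
      rewrite E1. apply (saturated_expand _ _ (E (Cons u1 u2)) _ (E' (Cons v1 v2))).
      1: apply WF; by_per.
      1,2: apply (red_cong (fun u => ElList u _ _)); auto using step_ElList.
      assert (C : env_rel (inst 2 M (Var 1) :: wk 1 A :: List A :: Γ)
         (scons (E u1) (scons u2 (scons u1 s))) (scons (E' v1) (scons v2 (scons v1 s')))).
      { assert (listR X u1 u1) by by_per. assert (listR X v1 v1) by by_per.
        eapply env_cons; [eapply env_cons; [eapply env_cons; eauto| | |]| | |].
        1,2: norm; eauto. 1: auto. 3: exact IH.
        - norm; apply HF; auto.
        - norm; rewrite (R _ _ Q1); apply HF; auto. }
      assert (WC : saturated (F (Cons u1 u2))) by (apply WF; by_per).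
      one_step WC.
      norm. apply (tmeq_at _ _ _ _ _ _ (F (Cons u1 u2)) Hl C). norm. apply HF; by_per. }
  exists (F (subst s t)); norm.
  split; [apply HF; by_per|]. split; [rewrite (R _ _ Qt); apply HF; by_per|]. apply Q; auto.
Qed.

(** All computation rules of sets: an element is equal to its reduct. *)
Lemma tmeq_step Γ t u A : tmeq Γ t t A ->
  (forall s, step (subst s t) = Some (subst s u)) -> tmeq Γ t u A.
Proof.
  intros H E s s' Hs; destruct (H s s' Hs) as (X & H1 & H2 & H3); exists X; repeat split; auto.
  apply (saturated_step_r X _ _ _ (coll_saturated _ _ H1) (E s')); auto.
Qed.

Lemma interp_Sig_at Γ A B s s' : tyeq Γ A A col -> tyeq (A :: Γ) B B col -> env_rel Γ s s' ->
  exists X F, interp coll (subst s A) X /\ interp coll (subst s' A) X /\ saturated X /\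
      respects X F /\
    (forall a, X a a ->
       interp coll (subst (scons a s) B) (F a) /\ interp coll (subst (scons a s') B) (F a) /\
           saturated (F a)) /\
    interp coll (subst s (Sig A B)) (sigR X F) /\ interp coll (subst s' (Sig A B)) (sigR X F) /\
    interp coll (subst s (Pi A B)) (piR X F) /\ interp coll (subst s' (Pi A B)) (piR X F).
Proof.
  intros HA HB Hs; interp_at HA Hs X; to_coll.
  destruct (motive_at _ _ _ s s' X HB Hs) as (F & R & HF & WF); auto.
  assert (B1 : forall a, X a a -> interp coll (inst 0 (subst (up s) B) a) (F a))
    by (intros; norm; apply HF; auto).
  assert (B2 : forall a, X a a -> interp coll (inst 0 (subst (up s') B) a) (F a))
    by (intros; norm; apply HF; auto).
  exists X, F; split; [auto|split; [auto|split; [eauto using coll_saturated|split;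
      [exact R|split]]]].
  - intros a Ha; destruct (HF a Ha); auto.
  - cbn [subst]; auto using interp_Sig, interp_Pi.
Qed.

Lemma tmeq_Pair Γ A B a a' b b' : tyeq Γ A A col -> tyeq (A :: Γ) B B col ->
  tmeq Γ a a' A -> tmeq Γ b b' (inst 0 B a) -> tmeq Γ (Pair a b) (Pair a' b') (Sig A B).
Proof.
  intros HA HB Ha Hb s s' Hs.
  destruct (interp_Sig_at _ _ _ _ _ HA HB Hs) as (X & F & ? & ? & ? & R & HF & ? & ? & _).
  destruct (tmeq_at _ _ _ _ _ _ X Ha Hs) as (_ & Q & _ & _ & Q' & _); auto.
  exists (sigR X F); repeat split; auto.
  exists (subst s a), (subst s b), (subst s' a'), (subst s' b').
  repeat split; try constructor; auto.
  apply (tmeq_at _ _ _ _ _ _ (F (subst s a)) Hb Hs); norm. apply HF; by_per.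
Qed.

Lemma tmeq_ElSig Γ A B M d d' m m' : tyeq Γ A A col -> tyeq (A :: Γ) B B col ->
  tyeq (Sig A B :: Γ) M M col -> tmeq Γ d d' (Sig A B) ->
  tmeq (B :: A :: Γ) m m' (inst 2 M (Pair (Var 1) (Var 0))) ->
  tmeq Γ (ElSig d m) (ElSig d' m') (inst 0 M d).
Proof.
  intros HA HB HM Hd Hm s s' Hs.
  destruct (interp_Sig_at _ _ _ _ _ HA HB Hs)
    as (X & F & X1 & X2 & WX & R & HF & S1 & S2 & _).
  destruct (motive_at _ _ _ s s' (sigR X F) HM Hs) as (G & RG & HG & WG); auto.
  destruct (tmeq_at _ _ _ _ _ _ (sigR X F) Hd Hs) as (_ & Qd & _ & _ & Qd' & _); auto.
  assert (WS : saturated (sigR X F)) by eauto using coll_saturated.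
  exists (G (subst s d)); norm.
  split; [apply HG; by_per|]. split; [rewrite (RG _ _ Qd); apply HG; by_per|].
  destruct Qd' as (t1 & t2 & u1 & u2 & Ht & Hu & H1 & H2).
  assert (X t1 t1) by by_per. assert (WF : saturated (F t1)) by (apply HF; auto).
  assert (P : sigR X F (Pair t1 t2) (Pair t1 t2)).
  { exists t1, t2, t1, t2; repeat split; try constructor; auto; by_per. }
  assert (E : G (subst s d) = G (Pair t1 t2)) by (apply RG, (saturated_red _ _ _ _ WS Ht); auto).
  rewrite E.
  apply (saturated_expand _ _ (ElSig (Pair t1 t2) (subst (up (up s)) m)) _
    (ElSig (Pair u1 u2) (subst (up (up s')) m'))); auto.
  1,2: apply (red_cong (fun u => ElSig u _)); auto using step_ElSig.
  one_step (WG _ P).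
  norm.
  assert (C : env_rel (B :: A :: Γ) (scons t2 (scons t1 s)) (scons u2 (scons u1 s'))).
  { eapply env_cons; [eapply env_cons; eauto| | |exact H2].
    - apply HF; auto.
    - rewrite (R _ _ H1); apply HF; by_per. }
  apply (tmeq_at _ _ _ _ _ _ (G (Pair t1 t2)) Hm C); norm; apply HG; auto.
Qed.

Lemma tmeq_Lam Γ A A' B b b' : tyeq Γ A A' col -> tmeq (A :: Γ) b b' B ->
  tyeq Γ (Pi A B) (Pi A B) col -> 
  tmeq Γ (Lam A b) (Lam A' b') (Pi A B).
Proof.
  intros HA Hb HP s s' Hs. interp_at HP Hs Z. clear Ty1 Ty2.
  exists Z; to_coll; repeat split; auto.
  cbn [subst] in H0. inversion H0; subst.
  destruct (tyeq_at _ _ _ _ _ _ HA Hs) as (X' & K1 & K2 & _); apply interp_kind_coll in K1, K2.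
  assert (X = X') by eauto using coll_unique; subst X'.
  intros u v Huv.
  assert (C : env_rel (A :: Γ) (scons u s) (scons v s')) by (eapply env_cons; eauto).
  assert (WX : saturated X) by eauto using coll_saturated.
  assert (X u u) by by_per.
  assert (T : interp coll (subst (scons u s) B) (F u)) by (rewrite <- inst_up; auto).
  one_step (coll_saturated _ _ T).
  norm. apply (tmeq_at _ _ _ _ _ _ (F u) Hb C); auto.
Qed.

Lemma tmeq_App Γ A B f f' a a' : tyeq Γ A A col -> tyeq (A :: Γ) B B col ->
  tmeq Γ f f' (Pi A B) -> tmeq Γ a a' A -> tmeq Γ (App f a) (App f' a') (inst 0 B a).
Proof.
  intros HA HB Hf Ha s s' Hs.
  destruct (interp_Sig_at _ _ _ _ _ HA HB Hs)
    as (X & F & X1 & X2 & WX & R & HF & _ & _ & P1 & P2).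
  destruct (tmeq_at _ _ _ _ _ _ X Ha Hs) as (_ & Q & _ & _ & Q' & _); auto.
  destruct (tmeq_at _ _ _ _ _ _ (piR X F) Hf Hs) as (_ & _ & _ & _ & Qf & _); auto.
  exists (F (subst s a)); norm.
  split; [apply HF; by_per|]. split; [rewrite (R _ _ Q); apply HF; by_per|]. apply Qf; auto.
Qed.

Lemma tmeq_eta Γ A B f : tmeq Γ f f (Pi A B) ->
  tmeq Γ (Lam A (App (wk 1 f) (Var 0))) f (Pi A B).
Proof.
  intros Hf s s' Hs; destruct (Hf s s' Hs) as (Z & H1 & H2 & H3).
  exists Z; repeat split; auto.
  pose proof H1 as H1'. cbn [subst] in H1'. inversion H1'; subst.
  intros u v Huv. assert (WX :
      saturated X) by eauto using coll_saturated. assert (X u u) by by_per.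
  apply (saturated_expand _ _ (App (subst s f) u) _ (App (subst s' f) v)); auto;
      [eauto using coll_saturated| |constructor].
  eapply red_step; [reflexivity|]. cbn [subst]. unfold inst; cbn [subst].
  rewrite (subst_subst (wk 1 f)), scons_up, subst_wk.
  cbn; rewrite subst_Var; constructor.
Qed.

Lemma interp_Plus_at Γ A B s s' : tyeq Γ A A set -> tyeq Γ B B set -> env_rel Γ s s' ->
  exists X Y, interp coll (subst s A) X /\ interp coll (subst s' A) X /\
      interp coll (subst s B) Y /\
    interp coll (subst s' B) Y /\ saturated X /\ saturated Y /\
    interp coll (subst s (Plus A B)) (plusR X Y) /\ interp coll (subst s' (Plus A B)) (plusR X Y).
Proof.
  intros H H' Hs; interp_at H Hs X; interp_at H' Hs Y; to_coll; exists X, Y.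
  cbn [subst]; eauto 12 using coll_saturated, interp_Plus.
Qed.

Lemma tmeq_Inl Γ A B a a' : tyeq Γ A A set -> tyeq Γ B B set -> tmeq Γ a a' A ->
  tmeq Γ (Inl a) (Inl a') (Plus A B).
Proof.
  intros HA HB Ha s s' Hs.
  destruct (interp_Plus_at _ _ _ _ _ HA HB Hs) as (X & Y & ? & ? & ? & ? & ? & ? & ? & ?).
  exists (plusR X Y); repeat split; auto. left; eexists _, _; repeat split; try constructor.
  apply (tmeq_at _ _ _ _ _ _ X Ha Hs); auto.
Qed.

Lemma tmeq_Inr Γ A B a a' : tyeq Γ A A set -> tyeq Γ B B set -> tmeq Γ a a' B ->
  tmeq Γ (Inr a) (Inr a') (Plus A B).
Proof.
  intros HA HB Ha s s' Hs.
  destruct (interp_Plus_at _ _ _ _ _ HA HB Hs) as (X & Y & ? & ? & ? & ? & ? & ? & ? & ?).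
  exists (plusR X Y); repeat split; auto. right; eexists _, _; repeat split; try constructor.
  apply (tmeq_at _ _ _ _ _ _ Y Ha Hs); auto.
Qed.

Lemma tmeq_ElPlus Γ A B M d d' b b' c c' : tyeq Γ A A set -> tyeq Γ B B set ->
  tyeq (Plus A B :: Γ) M M col -> tmeq Γ d d' (Plus A B) ->
  tmeq (A :: Γ) b b' (inst 1 M (Inl (Var 0))) ->
  tmeq (B :: Γ) c c' (inst 1 M (Inr (Var 0))) ->
  tmeq Γ (ElPlus d b c) (ElPlus d' b' c') (inst 0 M d).
Proof.
  intros HA HB HM Hd Hb Hc s s' Hs.
  destruct (interp_Plus_at _ _ _ _ _ HA HB Hs) as (X & Y & X1 & X2 & Y1 & Y2 & WX & WY & P1 & P2).
  destruct (motive_at _ _ _ s s' (plusR X Y) HM Hs) as (G & RG & HG & WG); auto.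
  destruct (tmeq_at _ _ _ _ _ _ (plusR X Y) Hd Hs) as (_ & Qd & _ & _ & Qd' & _); auto.
  assert (WS : saturated (plusR X Y)) by auto using saturated_plusR.
  exists (G (subst s d)); norm.
  split; [apply HG; by_per|]. split; [rewrite (RG _ _ Qd); apply HG; by_per|].
  destruct Qd' as [(t1 & u1 & Ht & Hu & H)|(t1 & u1 & Ht & Hu & H)].
  - assert (P : plusR X Y (Inl t1) (Inl t1)).
    { left; exists t1, t1; repeat split; try constructor; by_per. }
    assert (E : G (subst s d) = G (Inl t1)) by (apply RG, (saturated_red _ _ _ _ WS Ht); auto).
    rewrite E.
    eapply saturated_expand; [auto|eapply (red_cong (fun u => ElPlus u _ _));
        eauto using step_ElPlus..|].
    one_step (WG _ P).
    norm. assert (C : env_rel (A :: Γ) (scons t1 s) (scons u1 s')) by (eapply env_cons; eauto).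
    apply (tmeq_at _ _ _ _ _ _ (G (Inl t1)) Hb C); norm; apply HG; auto.
  - assert (P : plusR X Y (Inr t1) (Inr t1)).
    { right; exists t1, t1; repeat split; try constructor; by_per. }
    assert (E : G (subst s d) = G (Inr t1)) by (apply RG, (saturated_red _ _ _ _ WS Ht); auto).
    rewrite E.
    eapply saturated_expand; [auto|eapply (red_cong (fun u => ElPlus u _ _));
        eauto using step_ElPlus..|].
    one_step (WG _ P).
    norm. assert (C : env_rel (B :: Γ) (scons t1 s) (scons u1 s')) by (eapply env_cons; eauto).
    apply (tmeq_at _ _ _ _ _ _ (G (Inr t1)) Hc C); norm; apply HG; auto.
Qed.

(** * Quotients *)

Lemma family2 Γ A B B' k s s' X :
  tyeq (wk 1 A :: A :: Γ) B B' k -> env_rel Γ s s' -> interp coll (subst s A) X ->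
      interp coll (subst s' A) X ->
  exists G, (forall a a' b b', X a a' -> X b b' -> G a b = G a' b') /\
    forall a b, X a a -> X b b ->
      interp_kind k (subst (scons b (scons a s)) B) (G a b) /\
      interp_kind k (subst (scons b (scons a s')) B) (G a b) /\
      interp_kind k (subst (scons b (scons a s)) B') (G a b) /\
      interp_kind k (subst (scons b (scons a s')) B') (G a b).
Proof.
  intros H Hs H1 H2.
  set (G := fun a b t u => exists Y, interp_kind k (subst (scons b (scons a s)) B) Y /\ Y t u).
  assert (EG : forall a b Y, interp_kind k (subst (scons b (scons a s)) B) Y -> G a b = Y).
  { intros a b Y HY; apply rel_ext; intros t u; split; [|exists Y; auto].
    intros (Z & HZ & ?); assert (Y = Z) by eauto using interp_kind_unique; subst; auto. }
  assert (C : forall r r' a a' b b', env_rel Γ r r' -> interp coll (subst r A) X ->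
      interp coll (subst r' A) X ->
    X a a' -> X b b' ->
    env_rel (wk 1 A :: A :: Γ) (scons b (scons a r)) (scons b' (scons a' r'))).
  { intros; eapply env_cons; [eapply env_cons; eauto|norm; eauto..|auto]. }
  exists G; split.
  - intros a a' b b' Ha Hb.
    destruct (tyeq_at _ _ _ _ _ _ H (C s s a a' b b' (env_refl _ _ _ Hs) H1 H1 Ha Hb))
      as (Y & ? & ? & _).
    rewrite (EG a b Y), (EG a' b' Y); auto.
  - intros a b Ha Hb.
    destruct (tyeq_at _ _ _ _ _ _ H (C s s' a a b b Hs H1 H2 Ha Hb)) as (Y & ? & ? & ? & ?).
    rewrite (EG a b Y); auto.
Qed.

Lemma tyeq_Quot Γ A A' R R' : tyeq Γ A A' set -> tyeq (wk 1 A :: A :: Γ) R R' prop_s ->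
  holds (A :: Γ) (inst2 1 R (Var 0) (Var 0)) ->
  holds (R :: wk 1 A :: A :: Γ) (inst2 3 R (Var 1) (Var 2)) ->
  holds (inst2 4 R (Var 2) (Var 1) :: inst2 3 R (Var 2) (Var 1) :: wk 2 A :: wk 1 A :: A :: Γ)
    (inst2 5 R (Var 4) (Var 2)) ->
  tyeq Γ (Quot A R) (Quot A' R') set.
Proof.
  intros HA HR R1 R2 R3 s s' Hs; interp_at HA Hs X; to_coll.
  destruct (family2 _ _ _ _ _ s s' X HR Hs) as (G & RG & HG); auto.
  assert (Cs : env_rel Γ s s) by eauto using env_refl.
  assert (TG : forall a b, X a a -> X b b -> interp coll (subst (scons b (scons a s)) R) (G a b)).
  { intros a b Ha Hb; eapply interp_kind_coll; apply HG; auto. }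
  assert (C1 : forall a, X a a -> env_rel (A :: Γ) (scons a s) (scons a s)).
  { intros; eapply env_cons; eauto. }
  assert (C2 : forall a b, X a a -> X b b ->
    env_rel (wk 1 A :: A :: Γ) (scons b (scons a s)) (scons b (scons a s))).
  { intros; eapply env_cons; [auto|norm; eauto..|auto]. }
  assert (EQ : equiv_on X G).
  { split; [|split].
    - intros a Ha; apply (R1 (scons a s)); auto. norm; auto.
    - intros a b Ha Hb T. apply (R2 (scons Tru (scons b (scons a s)))).
      + eapply env_cons; eauto.
      + norm; auto.
    - intros a b c Ha Hb Hc T T'.
      apply (R3 (scons Tru (scons Tru (scons c (scons b (scons a s)))))).
      + eapply env_cons; [eapply env_cons; [eapply env_cons; [auto|norm;
          eauto..|auto]| | |exact T]
                        | | |exact T']; norm; auto.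
      + norm; auto. }
  exists (quotR X G); split; (apply interp_kind_intro; [|left; apply set_not_prop]);
    apply interp_Quot; auto;
    first [apply Ty|apply Ty2|intros a b Ha Hb; apply HG; auto; left; reflexivity
          |intros; rewrite inst2_up; apply HG; auto].
Qed.

Lemma eq_Quot_cong Γ A A' R R' : tyeq Γ (Quot A R) (Quot A R) set -> tyeq Γ A A' set ->
  tyeq (wk 1 A :: A :: Γ) R R' prop_s -> tyeq Γ (Quot A R) (Quot A' R') set.
Proof.
  intros HQ HA HR s s' Hs; interp_at HQ Hs Z; interp_at HA Hs X; to_coll.
  destruct (family2 _ _ _ _ _ s s' X HR Hs) as (G & RG & HG); auto.
  destruct Ty as [Q _]; cbn [subst level] in Q; inversion Q as
      [| | | | | | | |? ? X' G' HX' HG' IG' RG' EQ| | | | | | | | | |]; subst.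
  assert (X = X') by (eapply small_unique; [apply Ty3|auto]); subst X'.
  exists (quotR X G'); split; (apply interp_kind_intro; [|left; apply set_not_prop]); auto.
  apply interp_Quot; auto; [apply Ty6|].
  intros a b Ha Hb. assert (E : G a b = G' a b).
  { eapply small_unique; [|apply HG'; auto]. rewrite inst2_up; apply HG; auto. }
  rewrite <- E, inst2_up; apply HG; auto.
Qed.

Lemma interp_Quot_at Γ A R s s' : tyeq Γ (Quot A R) (Quot A R) col -> env_rel Γ s s' ->
  exists X G, interp coll (subst s A) X /\
    interp coll (subst s (Quot A R)) (quotR X G) /\
        interp coll (subst s' (Quot A R)) (quotR X G) /\
    (forall a b, X a a -> X b b -> interp coll (subst (scons b (scons a s)) R) (G a b)) /\
    (forall a a' b b', X a a' -> X b b' -> G a b = G a' b') /\ equiv_on X G /\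
    (forall a b, X a a -> X b b -> irrelevant (G a b)).
Proof.
  intros HQ Hs; interp_at HQ Hs Z; to_coll.
  pose proof H0 as Q; cbn [subst] in Q.
  inversion Q as [| | | | | | | |? ? X G HX HG IG R' EQ| | | | | | | | | |]; subst.
  exists X, G; refine (conj HX (conj H0 (conj H (conj _ (conj R' (conj EQ IG)))))).
  intros a b Ha Hb; rewrite <- inst2_up; auto.
Qed.

Lemma tmeq_Cls Γ A R a b : tyeq Γ (Quot A R) (Quot A R) col ->
  tmeq Γ a a A -> tmeq Γ b b A -> holds Γ (inst2 0 R a b) -> tmeq Γ (Cls a) (Cls b) (Quot A R).
Proof.
  intros HQ Ha Hb HR s s' Hs.
  destruct (interp_Quot_at _ _ _ _ _ HQ Hs) as (X & G & HX & H1 & H2 & HG & RG & EQ & IG).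
  destruct (tmeq_at _ _ _ _ _ _ X Ha Hs HX) as (_ & Qa & _).
  destruct (tmeq_at _ _ _ _ _ _ X Hb Hs HX) as (HX' & Qb & _).
  assert (W : saturated X) by eauto using coll_saturated.
  assert (X (subst s a) (subst s a)) by by_per. assert (X (subst s b) (subst s b)) by by_per.
  exists (quotR X G); refine (conj H1 (conj H2 _)).
  exists (subst s a), (subst s' b); repeat split; try constructor; auto; [by_per|].
  rewrite <- (RG (subst s a) (subst s a) _ _ H Qb).
  apply (HR s); [eauto using env_refl|]. norm. apply HG; auto.
Qed.

Lemma tmeq_Cls_refl Γ A R a : tyeq Γ (Quot A R) (Quot A R) col ->
  tmeq Γ a a A -> tmeq Γ (Cls a) (Cls a) (Quot A R).
Proof.
  intros HQ Ha; apply tmeq_Cls; auto. intros s Z Hs HZ.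
  destruct (interp_Quot_at _ _ _ _ _ HQ Hs) as (X & G & HX & H1 & H2 & HG & RG & EQ & IG).
  destruct (tmeq_at _ _ _ _ _ _ X Ha Hs HX) as (_ & Qa & _).
  norm_in HZ. rewrite (coll_unique _ _ _ HZ (HG _ _ Qa Qa)). apply (proj1 EQ); auto.
Qed.

Lemma holds_Cls Γ A R a b : tyeq Γ (Quot A R) (Quot A R) col ->
  tmeq Γ a a A -> tmeq Γ b b A -> tmeq Γ (Cls a) (Cls b) (Quot A R) -> holds Γ (inst2 0 R a b).
Proof.
  intros HQ Ha Hb H s Z Hs HZ.
  destruct (interp_Quot_at _ _ _ _ _ HQ Hs) as (X & G & HX & H1 & H2 & HG & RG & EQ & IG).
  destruct (tmeq_at _ _ _ _ _ _ X Ha Hs HX) as (_ & Qa & _).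
  destruct (tmeq_at _ _ _ _ _ _ X Hb Hs HX) as (_ & Qb & _).
  norm_in HZ. rewrite (coll_unique _ _ _ HZ (HG _ _ Qa Qb)).
  destruct (tmeq_at _ _ _ _ _ _ _ H Hs H1) as (_ & _ & _ & (t & u & Ht & Hu & _ & _ & T) & _).
  cbn [subst] in *.
  assert (Et : Cls (subst s a) = Cls t) by (eapply red_det; [constructor|eauto|reflexivity..]).
  assert (Eu : Cls (subst s b) = Cls u) by (eapply red_det; [constructor|eauto|reflexivity..]).
  injection Et as ->; injection Eu as ->; exact T.
Qed.

(** If [R] is true of two elements then it denotes the total relation under every
    substitution, whatever expression it is. *)
Lemma tmeq_rel Γ A R a b : tyeq Γ (Quot A R) (Quot A R) col ->
  tmeq Γ a a A -> tmeq Γ b b A -> holds Γ (inst2 0 R a b) ->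
  tmeq Γ Tru Tru (inst2 0 R a b).
Proof.
  intros HQ Ha Hb H.
  assert (T : forall s, env_rel Γ s s -> interp coll (subst s (inst2 0 R a b)) (truth True)).
  { intros s Hs.
    destruct (interp_Quot_at _ _ _ _ _ HQ Hs) as (X & G & HX & H1 & H2 & HG & RG & EQ & IG).
    destruct (tmeq_at _ _ _ _ _ _ X Ha Hs HX) as (_ & Qa & _).
    destruct (tmeq_at _ _ _ _ _ _ X Hb Hs HX) as (_ & Qb & _).
    assert (TG : interp coll (subst s (inst2 0 R a b)) (G (subst s a) (subst s b))) by (norm;
        auto).
    replace (truth True) with (G (subst s a) (subst s b)); auto.
    apply irrelevant_eq; auto using irrelevant_truth. split; [intros _; exact I|intros _;
        apply (H s); auto]. }
  intros s s' Hs; exists (truth True); repeat split;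
    [apply T; eauto using env_refl|apply T; eauto using env_refl'].
Qed.

(** The compatibility premise is used for the two representatives, under one
    substitution; then the two substitutions are compared at one representative. *)
Lemma tmeq_ElQuot Γ A R M p p' l l' :
  tyeq Γ A A col -> tyeq Γ (Quot A R) (Quot A R) col -> tyeq (Quot A R :: Γ) M M col ->
  tmeq Γ p p' (Quot A R) -> tmeq (A :: Γ) l l' (inst 1 M (Cls (Var 0))) ->
  tmeq (R :: wk 1 A :: A :: Γ) (inst 3 l (Var 2)) (inst 3 l (Var 1)) (inst 3 M (Cls (Var 2))) ->
  tmeq Γ (ElQuot p l) (ElQuot p' l') (inst 0 M p).
Proof.
  intros HA HQ HM Hp Hl Hc s s' Hs.
  destruct (interp_Quot_at _ _ _ _ _ HQ Hs) as (X & G & HX & H1 & H2 & HG & RG & EQ & IG).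
  destruct (motive_at _ _ _ s s' (quotR X G) HM Hs) as (F & R' & HF & WF); auto.
  destruct (tmeq_at _ _ _ _ _ _ (quotR X G) Hp Hs) as (_ & Qp & _ & _ & Qp' & _); auto.
  assert (WQ : saturated (quotR X G)) by auto using saturated_quotR.
  assert (HX' : interp coll (subst s' A) X).
  { interp_at HA Hs Y; to_coll. rewrite (coll_unique _ _ _ HX H0); auto. }
  exists (F (subst s p)); norm.
  split; [apply HF; by_per|]. split; [rewrite (R' _ _ Qp); apply HF; by_per|].
  destruct Qp' as (t & u & Ht & Hu & Xt & Xu & T).
  assert (P : quotR X G (Cls t) (Cls u)).
  { exists t, u; repeat split; try constructor; auto. }
  assert (Pt : quotR X G (Cls t) (Cls t)) by by_per.
  assert (E : F (subst s p) = F (Cls t)) by (apply R', (saturated_red _ _ _ _ WQ Ht); auto).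
  rewrite E.
  eapply saturated_expand; [auto|eapply (red_cong (fun u => ElQuot u _));
      eauto using step_ElQuot..|].
  one_step (WF _ Pt). norm.
  assert (C1 : env_rel (A :: Γ) (scons u s) (scons u s')) by (eapply env_cons; eauto).
  assert (C2 : env_rel (R :: wk 1 A :: A :: Γ) (scons Tru (scons u (scons t s)))
                  (scons Tru (scons u (scons t s)))).
  { eapply env_cons; [eapply env_cons; [eapply env_cons; eauto using env_refl|norm; eauto..|auto]
                    | | |exact T]; auto. }
  eapply (saturated_trans _ (WF _ Pt)).
  - destruct (tmeq_at _ _ _ _ _ _ (F (Cls t)) Hc C2) as (_ & _ & _ & Q & _).
    + norm; apply HF; auto.
    + norm_in Q; exact Q.
  - rewrite (R' _ _ P). apply (tmeq_at _ _ _ _ _ _ (F (Cls u)) Hl C1). norm; apply HF; by_per.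
Qed.

(** * Codes of small propositions *)

Lemma tyeq_Dec Γ C p q : (forall s, interp coll (subst s C) propR) ->
  tmeq Γ p q C -> tyeq Γ (Dec p) (Dec q) prop_s.
Proof.
  intros HC H s s' Hs; destruct (tmeq_at _ _ _ _ _ _ propR H Hs) as (_ & _ & _ & _ & Q & _); auto.
  destruct Q as (X & I & ? & ?); exists X; split; split; auto.
Qed.

Lemma tmeq_code Γ C p q : (forall s, interp coll (subst s C) propR) ->
  tyeq Γ (Dec p) (Dec q) prop_s -> tmeq Γ p q C.
Proof.
  intros HC H s s' Hs; exists propR; repeat split; auto.
  interp_at H Hs X; exists X; repeat split; [apply Ty; left; reflexivity|apply Ty|apply Ty2].
Qed.

Lemma interp_PropS_coll s : interp coll (subst s PropS) propR.
Proof. apply interp_PropS; reflexivity. Qed.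

Lemma interp_Pow1_coll s : interp coll (subst s Pow1) propR.
Proof. apply interp_Pow1; reflexivity. Qed.

Lemma tyeq_Dec_PropS Γ p q : tmeq Γ p q PropS -> tyeq Γ (Dec p) (Dec q) prop_s.
Proof. apply tyeq_Dec, interp_PropS_coll. Qed.

Lemma tyeq_decode Γ v P Q : (forall s, decode (subst s v) = Some (subst s P)) ->
  tyeq Γ P Q prop_s -> tyeq Γ (Dec v) Q prop_s.
Proof.
  intros E H s s' Hs; destruct (H s s' Hs) as (X & HX & HY); exists X; split; auto.
  destruct HX; split; auto. cbn [subst]; eapply interp_Dec; [constructor|apply E|auto].
Qed.

Lemma tyeq_code Γ v w P Q : (forall s, decode (subst s v) = Some (subst s P)) ->
  (forall s, decode (subst s w) = Some (subst s Q)) ->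
  (tyeq Γ (Dec v) (Dec w) prop_s <-> tyeq Γ P Q prop_s).
Proof.
  intros Ev Ew. split; intros H.
  - intros s s' Hs; interp_at H Hs X; exists X.
    destruct Ty as [T1 I], Ty2 as [T2 _]; cbn [subst level] in *.
    assert (D : forall v P, decode v = Some P -> interp None (Dec v) X -> interp None P X).
    { intros v' P' E' T; inversion T as
        [| | | | | | | | | | | | | | | | |p v2 P2 ? R2 E2 T2'|p t R2]; subst.
      - assert (v' = v2) by (eapply red_det; [constructor|eauto|eauto using decode_step..]).
        subst v2; congruence.
      - assert (v' = App oracle t) by (eapply red_det;
          [constructor|eauto|eauto using decode_step..]).
        subst v'; discriminate. }
    split; split; auto; eapply D; eauto.
  - eapply tyeq_decode; eauto. apply tyeq_sym; eapply tyeq_decode; eauto.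
    apply tyeq_sym; exact H.
Qed.

Lemma tyeq_Iff Γ P Q : tyeq Γ P P prop_s -> tyeq Γ Q Q prop_s ->
  (holds Γ (Iff P Q) <-> tyeq Γ P Q prop_s).
Proof.
  intros HP HQ.
  assert (E : forall s X Y, interp coll (subst s P) X -> interp coll (subst s Q) Y ->
     interp coll (subst s (Iff P Q)) (truth ((inh X -> inh Y) /\ (inh Y -> inh X)))).
  { intros s X Y HX HY; unfold Iff; cbn [subst].
    apply (interp_And coll _ _ (truth (inh X -> inh Y)) (truth (inh Y -> inh X)));
        apply interp_Imp; auto. }
  split; intros H.
  - intros s s' Hs; interp_at HP Hs X; interp_at HQ Hs Y; to_coll.
    assert (X = Y) as <-.
    { assert (I : isprop prop_s) by (left; reflexivity).
      apply irrelevant_eq; [apply Ty, I|apply Ty3, I|].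
      apply (H s (truth ((inh X -> inh Y) /\ (inh Y -> inh X)))); eauto using env_refl. }
    exists X; auto.
  - intros s Z Hs HZ; interp_at H Hs X; to_coll.
    rewrite (coll_unique _ _ _ HZ (E s X X ltac:(auto) ltac:(auto))). split; auto.
Qed.

Lemma tyeq_EqPow1 Γ U U' V V' : tmeq Γ U U' Pow1 -> tmeq Γ V V' Pow1 ->
  tyeq Γ (PEq Pow1 U V) (PEq Pow1 U' V') prop_s.
Proof.
  intros HU HV; apply (tyeq_Dec _ _ _ _ interp_Pow1_coll) in HU, HV.
  intros s s' Hs; interp_at HU Hs X; interp_at HV Hs Y; exists (truth (X = Y)).
  split; (apply interp_kind_intro; [|right; apply irrelevant_truth]); apply interp_PEqPow1;
    [apply Ty|apply Ty3|apply Ty2|apply Ty6].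
Qed.

(** A truth value is equal to the truth of its being equal to truth. *)
Lemma tyeq_eta Γ U : tmeq Γ U U Pow1 ->
  tyeq Γ (Dec U) (PEq Pow1 U (PCls Top)) prop_s.
Proof.
  intros HU; apply (tyeq_Dec _ _ _ _ interp_Pow1_coll) in HU.
  intros s s' Hs; interp_at HU Hs X; exists X; split; auto.
  set (Y := truth (inh (truth False) -> inh (truth False))).
  assert (HY : interp None (subst s' (Dec (PCls Top))) Y).
  { cbn [subst]; eapply interp_Dec; [constructor|reflexivity|].
    apply interp_Imp; apply interp_Bot. }
  assert (E : X = truth (X = Y)).
  { apply irrelevant_eq; [apply Ty; left; reflexivity|apply irrelevant_truth|].
    split; [intros T; apply irrelevant_eq; [apply Ty; left;
        reflexivity|apply irrelevant_truth|]|].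
    - split; [intros _ F; exact F|intros _; exact T].
    - intros T; unfold inh, truth in T; rewrite T; intros F; exact F. }
  rewrite E at 1. apply interp_kind_intro; [|right; apply irrelevant_truth].
  cbn [subst]; apply interp_PEqPow1; [apply Ty2|exact HY].
Qed.

Lemma tyeq_PropS Γ : tyeq Γ PropS PropS col.
Proof. intros s s' _; exists propR; split; (apply interp_kind_intro;
    [apply interp_PropS_coll|left; apply col_not_prop]). Qed.

Lemma tyeq_Pow1 Γ : tyeq Γ Pow1 Pow1 col.
Proof. intros s s' _; exists propR; split; (apply interp_kind_intro;
    [apply interp_Pow1_coll|left; apply col_not_prop]). Qed.

(** * Soundness *)

(** A product type that is well formed must have well formed components, but this cannot
    be recovered from its denotation: a relation of the form [piR X F] does not
    determine [F].  Application needs the components, so soundness is proved together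
    with this invariant.  Variables are excluded since a substitution instance of a
    variable could be a product. *)
Definition pi_inv (Γ : ctx) (A : exp) : Prop :=
  match A with
  | Var _ => False
  | Pi A B => tyeq Γ A A col /\ tyeq (A :: Γ) B B col
  | _ => True
  end.

Definition valid (Γ : ctx) (J : judgement) : Prop :=
  ctx_ok Γ /\
  match J with
  | isCtx => True
  | isTy A k => tyeq Γ A A k /\ pi_inv Γ A
  | eqTy A B k => tyeq Γ A B k
  | isTm a A => tmeq Γ a a A
  | eqTm a b A => tmeq Γ a b A
  end.

Lemma env_tail Γ A t t' : env_rel (A :: Γ) t t' ->
  env_rel Γ (fun n => t (S n)) (fun n => t' (S n)) /\
  exists X, interp coll (subst (fun n => t (S n)) A) X /\
      interp coll (subst (fun n => t' (S n)) A) X /\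
    X (t 0) (t' 0).
Proof.
  intros H; split.
  - intros n B E; destruct (H (S n) B E) as (X & HX); exists X; rewrite !subst_wk in *; exact HX.
  - destruct (H 0 A eq_refl) as (X & HX); exists X; rewrite !subst_wk in *; exact HX.
Qed.

Lemma subst_up_scons (t : nat -> exp) s :
  (fun n => subst t (up s n)) = scons (t 0) (fun n => subst (fun m => t (S m)) (s n)).
Proof. extensionality n; destruct n; simpl; [|rewrite subst_wk]; reflexivity. Qed.

Lemma pi_inv_subst Γ Δ s A : ctx_ok Δ ->
  (forall n A, nth_error Δ n = Some A -> tmeq Γ (s n) (s n) (subst s (wk (S n) A))) ->
  pi_inv Δ A -> pi_inv Γ (subst s A).
Proof.
  intros V H; destruct A; simpl; auto; [tauto|]. intros [HA HB]; split.
  - eapply tyeq_subst; eauto.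
  - intros t t' Ht; destruct (env_tail _ _ _ _ Ht) as (Ht' & X & T1 & T2 & HX).
    rewrite !subst_subst in *. apply HB. rewrite !subst_up_scons.
    eapply env_cons; eauto using env_comp.
Qed.

Lemma tyeq_inst Γ A M a : tyeq (A :: Γ) M M prop -> tmeq Γ a a A ->
  tyeq Γ (inst 0 M a) (inst 0 M a) prop.
Proof.
  intros HM Ha s s' Hs; destruct (Ha s s' Hs) as (X & H1 & H2 & H3); norm.
  apply HM; eapply env_cons; eauto.
Qed.

Lemma tyeq_inst2 Γ A M a b : tyeq (wk 1 A :: A :: Γ) M M prop -> tmeq Γ a a A -> tmeq Γ b b A ->
  tyeq Γ (inst2 0 M a b) (inst2 0 M a b) prop.
Proof.
  intros HM Ha Hb s s' Hs; destruct (Ha s s' Hs) as (X & H1 & H2 & H3); norm.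
  apply HM; eapply env_cons; [eapply env_cons; eauto|norm; eauto..|].
  apply (tmeq_at _ _ _ _ _ _ X Hb Hs); auto.
Qed.

Ltac prep :=
  repeat match goal with
  | H : valid _ _ |- _ => destruct H
  | H : ctx_ok (_ :: _) |- _ => destruct H
  | H : tyeq _ _ _ _ /\ _ |- _ => destruct H
  | H : pi_inv _ (Pi _ _) |- _ => destruct H
  end.

Lemma holds_cut Γ P Q : tyeq Γ P P prop -> tyeq Γ Q Q prop ->
  holds (P :: Γ) (wk 1 Q) -> holds Γ P -> holds Γ Q.
Proof. eauto using holds_mp, holds_Imp. Qed.

Lemma tyeq_wk1 Γ A B k : tyeq Γ B B k -> tyeq (A :: Γ) (wk 1 B) (wk 1 B) k.
Proof.
  intros H s s' Hs; apply env_tail in Hs; destruct Hs as [Hs _]; rewrite !subst_wk; auto.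
Qed.

Lemma tyeq_wk2 Γ A A' B k : tyeq Γ B B k -> tyeq (A' :: A :: Γ) (wk 2 B) (wk 2 B) k.
Proof.
  intros H s s' Hs; apply env_tail in Hs; destruct Hs as [Hs _];
    apply env_tail in Hs; destruct Hs as [Hs _]; rewrite !subst_wk; auto.
Qed.

Lemma tyeq_All' Γ A P : tyeq Γ A A col -> tyeq (A :: Γ) P P prop ->
    tyeq Γ (All A P) (All A P) prop.
Proof. apply (tyeq_All Γ A A P P large). Qed.
Lemma tyeq_Ex' Γ A P : tyeq Γ A A col -> tyeq (A :: Γ) P P prop -> tyeq Γ (Ex A P) (Ex A P) prop.
Proof. apply (tyeq_Ex Γ A A P P large). Qed.
Lemma tyeq_PEq' Γ A a b : tyeq Γ A A col -> tmeq Γ a a A -> tmeq Γ b b A ->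
  tyeq Γ (PEq A a b) (PEq A a b) prop.
Proof. apply (tyeq_PEq Γ A A a a b b large). Qed.
Lemma tyeq_Bot Γ k : tyeq Γ Bot Bot k.
Proof.
  apply tyeq_const with (X := truth False); auto using irrelevant_truth; constructor.
Qed.

Lemma holds_Tru Γ P : tmeq Γ Tru Tru P -> holds Γ P.
Proof. intros H s X Hs HX; apply (tmeq_at _ _ _ _ _ _ X H Hs HX). Qed.

Lemma tmeq_ty Γ a b A : tmeq Γ a b A -> tyeq Γ A A col.
Proof.
  intros H s s' Hs; destruct (H s s' Hs) as (X & ? & ? & _); exists X.
  split; (apply interp_kind_intro; [auto|left; apply col_not_prop]).
Qed.

Lemma tyeq_diag Γ A C : tyeq (wk 1 A :: A :: Γ) C C prop ->
  tyeq (A :: Γ) (inst2 1 C (Var 0) (Var 0)) (inst2 1 C (Var 0) (Var 0)) prop.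
Proof.
  intros HC s s' Hs; destruct (env_tail _ _ _ _ Hs) as (Hs' & X & H1 & H2 & H3); norm.
  apply HC; eapply env_cons; [eapply env_cons; eauto|norm; eauto..].
Qed.

Lemma holds_And1 Γ P Q : tyeq Γ P P prop -> tyeq Γ Q Q prop -> holds Γ (And P Q) -> holds Γ P.
Proof. intros; apply (holds_And Γ P Q); auto. Qed.

Lemma holds_And2 Γ P Q : tyeq Γ P P prop -> tyeq Γ Q Q prop -> holds Γ (And P Q) -> holds Γ Q.
Proof. intros; apply (holds_And Γ P Q); auto. Qed.

Ltac by_form := solve [eauto using holds_of_tmeq, tyeq_And, tyeq_Or, tyeq_Imp, tyeq_All',
    tyeq_Ex', tyeq_PEq', tyeq_wk1, tyeq_wk2, tyeq_inst, tyeq_inst2, tyeq_Bot].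

(** Every expression realizes a true proposition, so a rule that concludes to a
    judgement on proofs holds once its proposition is well formed and true. *)
Ltac by_truth := apply tmeq_of_holds; [by_form|].

Ltac by_computation :=
  intros; norm; cbn [step]; rewrite ?inst_up, ?inst2_up, ?inst3_up; reflexivity.

Ltac is_code P :=
  apply (tmeq_code _ _ _ _ interp_PropS_coll); apply tyeq_code with P P; [reflexivity..|].

Ltac decodes_to P := apply tyeq_decode with P; [reflexivity|].

Ltac is_class :=
  apply (tmeq_code _ _ _ _ interp_Pow1_coll); eapply tyeq_code; [reflexivity..|].

Ltac formation := split; [|exact I].

Theorem soundness T Γ J : Γ ⊢[T] J -> valid Γ J.
Proof.
  induction 1; prep; (split; [solve [cbn; auto]|]).
  - exact I.
  - exact I.
  - apply tmeq_var; assumption.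
  - split; eauto using tyeq_kle.
  - eauto using tyeq_kle.
  - assumption.
  - apply tyeq_sym; assumption.
  - eauto using tyeq_trans.
  - assumption.
  - apply tmeq_sym; assumption.
  - eauto using tmeq_trans.
  - eauto using tmeq_conv.
  - eauto using tmeq_conv.
  - assert (HS : forall n A, nth_error Δ n = Some A ->
      tmeq Γ (s n) (s n) (subst s (wk (S n) A))) by (intros n B E; apply (H1 n B E));
      destruct J; cbn [subst_j] in *; prep; try split; eauto using tyeq_subst, tmeq_subst,
      pi_inv_subst.
  - assert (HS : forall n A, nth_error Δ n = Some A ->
      tmeq Γ (s n) (t n) (subst s (wk (S n) A))) by (intros n B E; apply (H1 n B E));
      eauto using tyeq_subst.
  - assert (HS : forall n A, nth_error Δ n = Some A ->
      tmeq Γ (s n) (t n) (subst s (wk (S n) A))) by (intros n B E; apply (H1 n B E));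
      eauto using tmeq_subst.
  - formation; apply tyeq_const with (X := truth False); auto using set_not_prop; constructor.
  - eauto using tmeq_ElEmpty.
  - formation; apply tyeq_const with (X := truth True); auto using set_not_prop; constructor.
  - intros s s2 _; exists (truth True); repeat split; constructor.
  - apply tmeq_ElUnit; auto.
  - apply tmeq_ElUnit; auto.
  - formation; auto using tyeq_List.
  - auto using tyeq_List.
  - auto using tmeq_Nil.
  - auto using tmeq_Cons.
  - eapply tmeq_ElList; eauto.
  (* A computation rule follows from the elimination rule, which makes the left side an
     element of the motive, because the left side reduces to the right one. *)
  - eapply tmeq_step; [eapply tmeq_ElList; eauto using tmeq_Nil|reflexivity].
  - eapply tmeq_step; [eapply tmeq_ElList; eauto using tmeq_Cons|by_computation].
  - eapply tmeq_ElList; eauto.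
  - formation; auto using tyeq_Sig.
  - auto using tyeq_Sig.
  - apply tmeq_Pair; auto.
  - eapply tmeq_ElSig; eauto.
  - eapply tmeq_step; [eapply tmeq_ElSig; eauto using tmeq_Pair|by_computation].
  - eapply tmeq_ElSig; eauto.
  - split; [apply tyeq_Pi; auto using set_not_prop|split; eauto using tyeq_col].
  - apply tyeq_Pi; auto using set_not_prop.
  - split; [apply tyeq_Pi; eauto using col_not_prop, tyeq_col, tyeq_PropS|split;
      eauto using tyeq_col, tyeq_PropS].
  - apply tyeq_Pi; eauto using col_not_prop, tyeq_col, tyeq_PropS.
  - split; [apply tyeq_Pi; eauto using col_not_prop, tyeq_col, tyeq_Pow1|split;
      eauto using tyeq_col, tyeq_Pow1].
  - apply tyeq_Pi; eauto using col_not_prop, tyeq_col, tyeq_Pow1.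
  - apply tmeq_Lam; auto.
  - eapply tmeq_App; eauto.
  - eapply tmeq_step; [eapply tmeq_App; eauto using tmeq_Lam|by_computation].
  - apply tmeq_Lam; eauto using tyeq_col.
  - auto using tmeq_eta.
  - formation; auto using tyeq_Plus.
  - auto using tyeq_Plus.
  - auto using tmeq_Inl.
  - auto using tmeq_Inr.
  - apply tmeq_ElPlus with A B; eauto.
  - eapply tmeq_step; [apply tmeq_ElPlus with A B; eauto using tmeq_Inl|by_computation].
  - eapply tmeq_step; [apply tmeq_ElPlus with A B; eauto using tmeq_Inr|by_computation].
  - apply tmeq_ElPlus with A B; eauto.
  - formation; apply tyeq_Bot.
  - formation; auto using tyeq_And.
  - formation; auto using tyeq_Or.
  - formation; auto using tyeq_Imp.
  - formation; auto using tyeq_All.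
  - formation; auto using tyeq_Ex.
  - formation; auto using tyeq_PEq.
  - auto using tyeq_And.
  - auto using tyeq_Or.
  - auto using tyeq_Imp.
  - auto using tyeq_All.
  - auto using tyeq_Ex.
  - auto using tyeq_PEq.
  - by_truth; apply holds_Bot; eapply holds_of_tmeq; [apply tyeq_Bot|eassumption].
  - by_truth; apply holds_And; by_form.
  - by_truth; apply holds_And1 with Q; by_form.
  - by_truth; apply holds_And2 with P; by_form.
  - by_truth; by_form.
  - by_truth; by_form.
  - by_truth; apply holds_Or1; by_form.
  - by_truth; apply holds_Or2; by_form.
  - by_truth; apply (holds_Or_elim _ P Q); by_form.
  - by_truth; apply holds_cut with P; by_form.
  - by_truth; apply holds_cut with Q; by_form.
  - by_truth; apply holds_Imp; by_form.
  - by_truth; apply (holds_mp _ P); by_form.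
  - by_truth; apply holds_cut with P; by_form.
  - by_truth; apply holds_All; by_form.
  - by_truth; apply holds_All_elim with A; by_form.
  - by_truth; apply holds_All_elim with A; eauto using holds_All, holds_of_tmeq.
  - by_truth; apply holds_Ex with a; by_form.
  - by_truth; apply holds_Ex_elim with A P; by_form.
  - by_truth; apply holds_Ex_elim with A P; try by_form; apply holds_Ex with a; by_form.
  - by_truth; apply holds_PEq; auto.
  - by_truth; apply holds_Id_elim with A; auto; [apply holds_PEq; auto; eapply holds_of_tmeq;
      eauto using tyeq_PEq'|eapply holds_of_tmeq; eauto using tyeq_diag].
  - by_truth; apply holds_Id_elim with A; auto; eapply holds_of_tmeq; eauto using tyeq_diag.
  - split; [apply tyeq_PropS|exact I].
  - formation; eauto using tyeq_Dec_PropS.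
  - is_code Bot; apply tyeq_Bot.
  - is_code (And (Dec p) (Dec q)); apply tyeq_And; eauto using tyeq_Dec_PropS.
  - is_code (Or (Dec p) (Dec q)); apply tyeq_Or; eauto using tyeq_Dec_PropS.
  - is_code (Imp (Dec p) (Dec q)); apply tyeq_Imp; eauto using tyeq_Dec_PropS.
  - is_code (All A (Dec p)); apply (tyeq_All _ _ _ _ _ small); eauto using tyeq_Dec_PropS.
  - is_code (Ex A (Dec p)); apply (tyeq_Ex _ _ _ _ _ small); eauto using tyeq_Dec_PropS.
  - is_code (PEq A a b); apply (tyeq_PEq _ _ _ _ _ _ _ small); auto.
  - decodes_to Bot; apply tyeq_Bot.
  - decodes_to (And (Dec p) (Dec q)); apply tyeq_And; eauto using tyeq_Dec_PropS.
  - decodes_to (Or (Dec p) (Dec q)); apply tyeq_Or; eauto using tyeq_Dec_PropS.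
  - decodes_to (Imp (Dec p) (Dec q)); apply tyeq_Imp; eauto using tyeq_Dec_PropS.
  - decodes_to (All A (Dec p)); apply (tyeq_All _ _ _ _ _ small); eauto using tyeq_Dec_PropS.
  - decodes_to (Ex A (Dec p)); apply (tyeq_Ex _ _ _ _ _ small); eauto using tyeq_Dec_PropS.
  - decodes_to (PEq A a b); apply (tyeq_PEq _ _ _ _ _ _ _ small); auto.
  - apply tmeq_of_holds; eauto using holds_of_tmeq.
  - apply tmeq_of_holds; eauto using holds_of_tmeq.
  - by_truth; apply holds_Bot; eapply holds_of_tmeq; [apply tyeq_Bot|eassumption].
  - by_truth; apply holds_And; by_form.
  - by_truth; apply holds_And1 with Q; by_form.
  - by_truth; apply holds_And2 with P; by_form.
  - by_truth; apply holds_Or1; by_form.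
  - by_truth; apply holds_Or2; by_form.
  - by_truth; apply (holds_Or_elim _ P Q); by_form.
  - by_truth; apply holds_Imp; by_form.
  - by_truth; apply (holds_mp _ P); by_form.
  - by_truth; apply holds_All; by_form.
  - by_truth; apply holds_All_elim with A; by_form.
  - by_truth; apply holds_Ex with a; by_form.
  - by_truth; apply holds_Ex_elim with A P; by_form.
  - by_truth; apply holds_PEq; auto.
  - apply holds_PEq; eauto using holds_Tru, tmeq_ty.
  - formation; apply tyeq_Quot; auto using holds_Tru.
  - eauto using eq_Quot_cong.
  - eauto using tmeq_Cls_refl, tyeq_col.
  - apply tmeq_Cls; eauto using tyeq_col, holds_Tru.
  - apply tmeq_rel with A; eauto using tyeq_col, holds_Cls.
  - eapply tmeq_ElQuot; eauto.
  - eapply tmeq_step; [eapply tmeq_ElQuot; eauto using tmeq_Cls_refl|by_computation].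
  - eapply tmeq_ElQuot; eauto.
  - split; [apply tyeq_Pow1|exact I].
  - is_class; auto.
  - is_class; apply tyeq_Iff; auto using holds_Tru.
  - apply tmeq_of_holds; [unfold Iff; eauto 6 using tyeq_And, tyeq_Imp, tyeq_kle, kle|];
      apply tyeq_Iff; auto; apply (tyeq_code Γ (PCls P) (PCls Q) P Q); [reflexivity..|];
      eauto using tyeq_Dec, interp_Pow1_coll.
  - formation; auto using tyeq_EqPow1.
  - apply (tmeq_code _ _ _ _ interp_Pow1_coll); apply tyeq_sym; eapply tyeq_decode;
      [reflexivity|]; apply tyeq_sym, tyeq_eta; auto.
Qed.

End Model.

(** * The diagonal argument *)

(** A prefix code: the tag of a constructor determines how many codes follow.  The
    second argument is the rest of the list. *)
Fixpoint encode (e : exp) (l : list nat) : list nat :=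
  match e with
  | Var n => 0 :: n :: l
  | Empty => 1 :: l
  | Unit => 2 :: l
  | List A => 3 :: encode A l
  | Sig A B => 4 :: encode A (encode B l)
  | Pi A B => 5 :: encode A (encode B l)
  | Plus A B => 6 :: encode A (encode B l)
  | Quot A R => 7 :: encode A (encode R l)
  | PropS => 8 :: l
  | Pow1 => 9 :: l
  | Bot => 10 :: l
  | And P Q => 11 :: encode P (encode Q l)
  | Or P Q => 12 :: encode P (encode Q l)
  | Imp P Q => 13 :: encode P (encode Q l)
  | All A P => 14 :: encode A (encode P l)
  | Ex A P => 15 :: encode A (encode P l)
  | PEq A a b => 16 :: encode A (encode a (encode b l))
  | Dec p => 17 :: encode p l
  | ElEmpty a => 18 :: encode a l
  | Star => 19 :: l
  | ElUnit t c => 20 :: encode t (encode c l)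
  | Nil => 21 :: l
  | Cons s a => 22 :: encode s (encode a l)
  | ElList s a l0 => 23 :: encode s (encode a (encode l0 l))
  | Pair a b => 24 :: encode a (encode b l)
  | ElSig d m => 25 :: encode d (encode m l)
  | Lam A b => 26 :: encode A (encode b l)
  | App f a => 27 :: encode f (encode a l)
  | Inl a => 28 :: encode a l
  | Inr b => 29 :: encode b l
  | ElPlus d b c => 30 :: encode d (encode b (encode c l))
  | Cls a => 31 :: encode a l
  | ElQuot p l0 => 32 :: encode p (encode l0 l)
  | PCls P => 33 :: encode P l
  | cBot => 34 :: l
  | cAnd p q => 35 :: encode p (encode q l)
  | cOr p q => 36 :: encode p (encode q l)
  | cImp p q => 37 :: encode p (encode q l)
  | cAll A p => 38 :: encode A (encode p l)
  | cEx A p => 39 :: encode A (encode p l)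
  | cEq A a b => 40 :: encode A (encode a (encode b l))
  | ElBot a => 41 :: encode a l
  | PairAnd a b => 42 :: encode a (encode b l)
  | FstAnd d => 43 :: encode d l
  | SndAnd d => 44 :: encode d l
  | InlOr a => 45 :: encode a l
  | InrOr b => 46 :: encode b l
  | ElOr d b c => 47 :: encode d (encode b (encode c l))
  | LamImp P b => 48 :: encode P (encode b l)
  | AppImp f a => 49 :: encode f (encode a l)
  | LamAll A b => 50 :: encode A (encode b l)
  | AppAll f a => 51 :: encode f (encode a l)
  | PairEx a b => 52 :: encode a (encode b l)
  | ElEx d m => 53 :: encode d (encode m l)
  | Refl A a => 54 :: encode A (encode a l)
  | ElId p c => 55 :: encode p (encode c l)
  | Tru => 56 :: l
  end.

(** Comparing tags as booleans lets most of the cases of [encode_inj] be refuted by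
    computation. *)
Lemma encode_tag e e' l l' : encode e l = encode e' l' ->
    Nat.eqb (hd 0 (encode e [])) (hd 0 (encode e' [])) = true.
Proof.
  intros E; apply Nat.eqb_eq.
  replace (hd 0 (encode e [])) with (hd 0 (encode e l)) by (destruct e; reflexivity).
  rewrite E; destruct e'; reflexivity.
Qed.

Lemma encode_inj e : forall e' l l', encode e l = encode e' l' -> e = e' /\ l = l'.
Proof.
  induction e; intros e' l l' E; assert (E' := encode_tag _ _ _ _ E);
    destruct e'; try (exfalso; exact (Bool.diff_false_true E')); clear E'; simpl in E;
        injection E; clear E; intros;
    repeat match goal with
    | IH : forall e' l l', encode ?e l = encode e' l' -> _, H : encode ?e _ = encode _ _ |- _ =>
        apply IH in H; destruct H
    end; subst; auto.
Qed.

Fixpoint list_code (l : list nat) : nat :=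
  match l with [] => 0 | n :: l => S (Cantor.to_nat (n, list_code l)) end.

Lemma list_code_inj l : forall l', list_code l = list_code l' -> l = l'.
Proof.
  induction l as [|n l IH]; intros [|n' l'] E; try discriminate E; auto.
  apply eq_add_S in E. apply Cantor.to_nat_inj in E. injection E as -> E. f_equal; auto.
Qed.

Definition code (e : exp) : nat := list_code (encode e []).

Lemma code_inj e e' : code e = code e' -> e = e'.
Proof. intros E; apply list_code_inj, encode_inj in E; apply E. Qed.

Fixpoint num (n : nat) : exp :=
  match n with 0 => Nil | S n => Cons (num n) Star end.

Inductive isnum : exp -> nat -> Prop :=
| isnum_0 t : red t Nil -> isnum t 0
| isnum_S t u c n : red t (Cons u c) -> isnum u n -> isnum t (S n).

Lemma isnum_num n : isnum (num n) n.
Proof. induction n; econstructor; eauto; constructor. Qed.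

Lemma isnum_fun t n : isnum t n -> forall m, isnum t m -> n = m.
Proof.
  induction 1 as [t H|t u c n H Hn IH]; intros m Hm;
    destruct Hm as [t H'|t u' c' m H' Hm]; auto;
    assert (E := red_det _ _ _ H H' eq_refl eq_refl); try discriminate E.
  injection E as <- <-; auto.
Qed.

Definition numR : rel := listR (truth True).

Lemma numR_isnum t u : numR t u <-> exists n, isnum t n /\ isnum u n.
Proof.
  split.
  - induction 1 as [t u|t u t1 t2 u1 u2 Ht Hu _ (n & IH1 & IH2) _].
    + exists 0; split; constructor; auto.
    + exists (S n); split; econstructor; eauto.
  - intros (n & Ht & Hu); revert u Hu.
    induction Ht as [t Ht|t t1 t2 n Ht _ IH]; intros u Hu; inversion Hu; subst.
    + constructor 1; auto.
    + eapply listR_cons; [exact Ht|eassumption|apply IH; auto|exact I].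
Qed.

Definition zero_at_code (n : nat) : Prop := exists e, code e = n /\ isnum (App e (num n)) 0.

(** The graph of a function that differs at [n] from the function realized by the
    expression with code [n]. *)
Definition diag (n k : nat) : Prop := (zero_at_code n /\ k = 1) \/ (~ zero_at_code n /\ k = 0).

Lemma diag_total n : exists k, diag n k.
Proof. destruct (classic (zero_at_code n)); [exists 1; left|exists 0; right]; auto. Qed.

Lemma diag_fun n k k' : diag n k -> diag n k' -> k = k'.
Proof. intros [[? ->]|[? ->]] [[? ->]|[? ->]]; tauto. Qed.

Lemma diag_not_repr e k : isnum (App e (num (code e))) k -> ~ diag (code e) k.
Proof.
  intros H [[(e' & E & H') ->]|[N ->]].
  - apply code_inj in E; subst e'. discriminate (isnum_fun _ _ H _ H').
  - apply N; exists e; auto.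
Qed.

Definition diag_graph (t : exp) : Prop :=
  exists a b n k, red t (Pair a b) /\ isnum a n /\ isnum b k /\ diag n k.

Lemma diag_graph_Pair a b n k : isnum a n -> isnum b k -> (diag_graph (Pair a b) <-> diag n k).
Proof.
  intros Ha Hb; split.
  - intros (a' & b' & n' & k' & H & Ha' & Hb' & D).
    assert (E : Pair a b = Pair a' b') by (eapply red_det; [constructor|eauto|reflexivity..]).
    injection E as <- <-.
    rewrite (isnum_fun _ _ Ha _ Ha'), (isnum_fun _ _ Hb _ Hb'); auto.
  - intros D; exists a, b, n, k; repeat split; auto; constructor.
Qed.

Lemma diag_graph_resp t u : sigR numR (fun _ => numR) t u -> diag_graph t <-> diag_graph u.
Proof.
  intros (t1 & t2 & u1 & u2 & Ht & Hu & H1 & H2).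
  apply numR_isnum in H1, H2. destruct H1 as (n & N1 & N1'), H2 as (k & N2 & N2').
  assert (Q : forall t, red t (Pair t1 t2) \/ red t (Pair u1 u2) -> diag_graph t <-> diag n k).
  { intros v Hv; split.
    - intros (a & b & n' & k' & H & Ha & Hb & D).
      destruct Hv as [Hv|Hv]; assert (E := red_det _ _ _ H Hv eq_refl eq_refl);
        injection E as -> ->;
        rewrite (isnum_fun _ _ N1 _ Ha) || rewrite (isnum_fun _ _ N1' _ Ha);
        rewrite (isnum_fun _ _ N2 _ Hb) || rewrite (isnum_fun _ _ N2' _ Hb); auto.
    - intros D; destruct Hv as [Hv|Hv]; do 4 eexists; eauto. }
  rewrite (Q t), (Q u); tauto.
Qed.

(** * Refuting unique choice *)

Local Notation interp_diag := (interp diag_graph (coll diag_graph)).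

Definition oracle_env (n : nat) : exp := oracle.

Lemma interp_N orc_true U s : interp orc_true U (subst s N) numR.
Proof. apply interp_List, interp_Unit. Qed.

(** Nothing has to be computed to see that [oracle] is an element of the function type:
    whatever [t] is, [Dec (App oracle t)] denotes a truth value, which depends on [t]
    only up to equality of pairs. *)
Lemma env_oracle C : (forall s, subst s C = C) -> interp_diag C (propR diag_graph) ->
  env_rel diag_graph [Pi (Sig N N) C] oracle_env oracle_env.
Proof.
  intros EC HC [|n] A E; [|destruct n; discriminate E]. injection E as <-.
  exists (piR (sigR numR (fun _ => numR)) (fun _ => propR diag_graph)).
  assert (T : interp_diag (subst oracle_env (wk 1 (Pi (Sig N N) C)))
                (piR (sigR numR (fun _ => numR)) (fun _ => propR diag_graph))).
  { rewrite subst_wk; cbn [subst]; rewrite EC; apply interp_Pi.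
    - apply interp_Sig; [apply interp_N|intros; apply interp_N|intros ? ? _; reflexivity].
    - intros; unfold inst; rewrite EC; auto.
    - intros ? ? _; reflexivity. }
  repeat split; auto.
  intros t u H; exists (truth (diag_graph t)); split; [apply irrelevant_truth|split].
  - apply interp_orc with (orc_true := diag_graph); constructor.
  - replace (truth (diag_graph t)) with (truth (diag_graph u)); [apply interp_orc; constructor|].
    apply truth_ext; symmetry; apply diag_graph_resp, H.
Qed.

Lemma interp_subst_All orc_true U s A P X F : interp orc_true U (subst s A) X ->
  (forall a, X a a -> interp orc_true U (subst (scons a s) P) (F a)) -> respects X F ->
  interp orc_true U (subst s (All A P)) (truth (forall a, X a a -> inh (F a))).
Proof. intros; apply interp_All; auto; intros; fold subst; rewrite inst_up; auto. Qed.

Lemma interp_subst_Ex orc_true U s A P X F : interp orc_true U (subst s A) X ->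
  (forall a, X a a -> interp orc_true U (subst (scons a s) P) (F a)) -> respects X F ->
  interp orc_true U (subst s (Ex A P)) (truth (exists a, X a a /\ inh (F a))).
Proof. intros; apply interp_Ex; auto; intros; fold subst; rewrite inst_up; auto. Qed.

Lemma interp_subst_Imp orc_true U s P Q X Y : interp orc_true U (subst s P) X ->
    interp orc_true U (subst s Q) Y ->
  interp orc_true U (subst s (Imp P Q)) (truth (inh X -> inh Y)).
Proof. apply interp_Imp. Qed.

Lemma interp_subst_And orc_true U s P Q X Y : interp orc_true U (subst s P) X ->
    interp orc_true U (subst s Q) Y ->
  interp orc_true U (subst s (And P Q)) (truth (inh X /\ inh Y)).
Proof. apply interp_And. Qed.

(** The hypothesis says that [R] denotes the graph of [diag].  The denotation of the
    instance is computed to be [Pre -> Post], where [Pre] says that [diag] is a function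
    and [Post] that some expression realizes it; the diagonal argument refutes
    [Post] at the code of that expression. *)
Lemma AC_NN_false R :
  (forall a b,
      interp_diag (subst (scons b (scons a oracle_env)) R) (truth (diag_graph (Pair a b)))) ->
  forall X t u, interp_diag (subst oracle_env (AC_NN R)) X -> ~ X t u.
Proof.
  intros HR.
  set (Q := fun a b => diag_graph (Pair a b)).
  assert (RQ : forall a a' b b', numR a a' -> numR b b' -> Q a b <-> Q a' b').
  { intros a a' b b' Ha Hb; apply diag_graph_resp;
    exists a, b, a', b'; repeat split; auto; constructor. }
  set (Pre := forall a, numR a a ->
    (exists b, numR b b /\ Q a b) /\
    (forall y, numR y y -> forall z, numR z z -> Q a y /\ Q a z -> numR y z)).
  set (Post := exists f, piR numR (fun _ => numR) f f /\ forall a, numR a a -> Q a (App f a)).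
  assert (W : saturated numR) by (apply saturated_listR, saturated_truth).
  assert (T : interp_diag (subst oracle_env (AC_NN R)) (truth (Pre -> Post))).
  { assert (TN : forall s, interp_diag (subst s N) numR) by (intros; apply interp_N).
    assert (TN' : forall s k, interp_diag (subst s (wk k N)) numR) by (intros; apply interp_N).
    unfold AC_NN, ExUnique.
    apply (interp_subst_Imp diag_graph _ _ _ _ (truth Pre) (truth Post)).
    - apply (interp_subst_All diag_graph _ _ _ _ numR (fun a => truth ((exists b, numR b b /\
        Q a b) /\
        (forall y, numR y y -> forall z, numR z z -> Q a y /\ Q a z -> numR y z)))); auto.
      + intros a Ha.
        apply (interp_subst_And diag_graph _ _ _ _ (truth (exists b, numR b b /\ Q a b))
          (truth (forall y, numR y y -> forall z, numR z z -> Q a y /\ Q a z -> numR y z))).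
        * apply (interp_subst_Ex diag_graph _ _ _ _ numR (fun b => truth (Q a b))); auto.
          intros b b' Hb; apply truth_ext, RQ; auto.
        * apply (interp_subst_All diag_graph _ _ _ _ numR
            (fun y => truth (forall z, numR z z -> Q a y /\ Q a z -> numR y z))); auto.
          -- intros y Hy.
             apply (interp_subst_All diag_graph _ _ _ _ numR (fun z => truth (Q a y /\ Q a z ->
                 numR y z))); auto.
             ++ intros z Hz.
                apply (interp_subst_Imp diag_graph _ _ _ _ (truth (Q a y /\
                    Q a z)) (truth (numR y z))).
                ** apply (interp_subst_And diag_graph _ _ _ _ (truth (Q a y)) (truth (Q a z)));
                     rewrite subst_inst; apply HR.
                ** apply interp_PEq; auto; discriminate.
             ++ intros z z' Hz; apply truth_ext.
                assert (Q a z <-> Q a z') by (apply RQ; auto).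
                assert (numR y z <-> numR y z') by
                  (split; intros;
                      [apply (saturated_trans numR W) with z|apply (saturated_trans numR W) with
                      z']; by_per).
                tauto.
          -- intros y y' Hy; apply truth_ext.
             assert (EQ : Q a y <-> Q a y') by (apply RQ; auto).
             split; intros H z Hz [q1 q2];
               [apply (saturated_trans numR W) with y|apply (saturated_trans numR W) with y'];
               solve [by_per|apply H; tauto].
      + assert (I : forall a a', numR a a' ->
          (exists b, numR b b /\ Q a b) /\
          (forall y, numR y y -> forall z, numR z z -> Q a y /\ Q a z -> numR y z) ->
          (exists b, numR b b /\ Q a' b) /\
          (forall y, numR y y -> forall z, numR z z -> Q a' y /\ Q a' z -> numR y z)).
        { intros a a' Ha [(b & Hb & q) U]; split.
          - exists b; split; auto; apply (RQ a a' b b); auto.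
          - intros y Hy z Hz [q1 q2]; apply U; auto; split; eapply RQ; eauto. }
        intros a a' Ha; apply truth_ext; split; apply I; auto; by_per.
    - apply (interp_subst_Ex diag_graph _ _ _ _ (piR numR (fun _ => numR))
        (fun f => truth (forall a, numR a a -> Q a (App f a)))).
      + apply interp_Pi; auto; [|intros ? ? _; reflexivity].
        intros; rewrite inst_up; auto.
      + intros f Hf.
        apply (interp_subst_All diag_graph _ _ _ _ numR (fun a => truth (Q a (App f a)))); auto.
        * intros a Ha; rewrite subst_inst2; apply HR.
        * intros a a' Ha; apply truth_ext, RQ; auto.
      + intros f f' Hf; apply truth_ext.
        assert (E : forall a, numR a a -> Q a (App f a) <-> Q a (App f' a))
          by (intros a Ha; apply RQ; auto).
        split; intros H a Ha; apply E; auto. }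
  intros X t u HX TX. rewrite (coll_unique _ _ _ _ HX T) in TX.
  assert (HPre : Pre).
  { intros a Ha; apply numR_isnum in Ha; destruct Ha as (n & Hn & _); split.
    - destruct (diag_total n) as (k & D); exists (num k); split.
      + apply numR_isnum; exists k; auto using isnum_num.
      + apply (diag_graph_Pair _ _ n k); auto using isnum_num.
    - intros y Hy z Hz [Qy Qz]; apply numR_isnum in Hy, Hz.
      destruct Hy as (k & Hy & _), Hz as (k' & Hz & _); apply numR_isnum.
      apply (diag_graph_Pair a y n k) in Qy; auto. apply (diag_graph_Pair a z n k') in Qz; auto.
      exists k; split; auto. rewrite (diag_fun _ _ _ Qy Qz); auto. }
  destruct (TX HPre) as (f & Hf & Hg).
  assert (Nn : numR (num (code f)) (num (code f))).
  { apply numR_isnum; exists (code f); auto using isnum_num. }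
  pose proof (Hf _ _ Nn) as Hk; apply numR_isnum in Hk; destruct Hk as (k & Hk & _).
  apply (diag_not_repr f k Hk), (diag_graph_Pair _ _ _ _ (isnum_num _) Hk), Hg, Nn.
Qed.

(** * Typing the instance *)

Lemma isTy_N T Γ : Γ ⊢[T] isCtx -> Γ ⊢[T] isTy N set.
Proof. intros; apply F_List, F_Unit; auto. Qed.

Lemma ctx_N T Γ : Γ ⊢[T] isCtx -> (N :: Γ) ⊢[T] isCtx.
Proof. intros; apply ctx_cons, ty_cum with set, isTy_N; auto using kle. Qed.

Lemma isTy_NN T Γ : Γ ⊢[T] isCtx -> Γ ⊢[T] isTy (Sig N N) set.
Proof. intros; apply (F_Sig T Γ N N small); apply isTy_N; auto using ctx_N. Qed.

Lemma isTm_oracle_app T C : (forall s, subst s C = C) -> (forall r, ren r C = C) ->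
  (forall Γ, Γ ⊢[T] isCtx -> Γ ⊢[T] isTy (Arr (Sig N N) C) col) ->
  [N; N; Arr (Sig N N) C] ⊢[T] isTm (App (Var 2) (Pair (Var 1) (Var 0))) C.
Proof.
  intros ES ER HC.
  assert (Q : [N; N; Arr (Sig N N) C] ⊢[T] isCtx).
  { apply ctx_N, ctx_N, ctx_cons, HC, ctx_nil. }
  assert (EC : Arr (Sig N N) C = Pi (Sig N N) C).
  { unfold Arr, wk; rewrite ER; reflexivity. }
  replace C with (inst 0 C (Pair (Var 1) (Var 0))) at 2 by apply ES.
  apply E_Pi with (Sig N N).
  - rewrite <- EC; auto.
  - replace (Pi (Sig N N) C) with (wk 3 (Arr (Sig N N) C)).
    + apply var; auto.
    + rewrite EC; unfold wk; cbn [ren]; rewrite ER; reflexivity.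
  - apply I_Sig.
    + apply (var T _ 1 N); auto.
    + apply (var T _ 0 N); auto.
    + apply ty_cum with set, isTy_N, ctx_N; auto using kle.
Qed.

Lemma AC_NN_underivable T C R : (forall s, subst s C = C) -> (forall r, ren r C = C) ->
  interp_diag C (propR diag_graph) ->
  (forall a b,
      interp_diag (subst (scons b (scons a oracle_env)) R) (truth (diag_graph (Pair a b)))) ->
  ~ derivable T [Arr (Sig N N) C] (AC_NN R).
Proof.
  intros ES ER HC HR [p Hp]. unfold Arr, wk in Hp; rewrite ER in Hp.
  apply (soundness diag_graph) in Hp; destruct Hp as [_ Hp].
  destruct (Hp _ _ (env_oracle C ES HC)) as (X & HX & _ & Hpp).
  apply (AC_NN_false R HR X _ _ HX Hpp).
Qed.

Theorem corollary6p9 :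
  does_not_validate_AC_NN emTT /\ does_not_validate_AC_NN mTT.
Proof.
  split.
  (* In P(1), the small proposition with truth value U is U = [Top]. *)
  - exists [Arr (Sig N N) Pow1], (PEq Pow1 (App (Var 2) (Pair (Var 1) (Var 0))) (PCls Top));
      split.
    + assert (Q := isTm_oracle_app emTT Pow1 (fun _ => eq_refl) (fun _ => eq_refl)
        (fun Γ HΓ => F_ArrPow1 Γ _ (isTy_NN emTT Γ HΓ))).
      apply F_EqPow1; [exact Q|].
      apply I_Pow1, (F_Imp _ _ _ _ small); apply F_Bot; apply ctx_N, ctx_N, ctx_cons, F_ArrPow1,
          isTy_NN, ctx_nil.
    + apply AC_NN_underivable; [reflexivity|reflexivity|apply interp_Pow1; reflexivity|].
      intros a b; cbn [subst scons].
      replace (truth (diag_graph (Pair a b))) with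
        (truth (truth (diag_graph (Pair a b)) = truth (False -> False))).
      * apply interp_PEqPow1; [apply interp_orc with (orc_true := diag_graph); constructor|].
        eapply interp_Dec; [constructor|reflexivity|].
        apply (interp_Imp _ _ _ _ (truth False) (truth False)); constructor.
      * apply truth_ext; split.
        -- intros E. change (inh (truth (diag_graph (Pair a b)))); rewrite E; intros F; exact F.
        -- intros G; apply truth_ext; tauto.
  - exists [Arr (Sig N N) PropS], (Dec (App (Var 2) (Pair (Var 1) (Var 0)))); split.
    + apply F_Dec, isTm_oracle_app; auto. intros; apply F_ArrPropS, isTy_NN; auto.
    + apply AC_NN_underivable; [reflexivity|reflexivity|apply interp_PropS; reflexivity|].
      intros a b; apply interp_orc with (orc_true := diag_graph); constructor.
Qed.
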